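(* Let $X\in\mathbb{P}_m$, $\mu\in\mathcal{P}^1(\mathbb{P}_m)$ and $\beta(t)=G(X\#_t\mu)$ for $t\in\mathbb{R}$ (which is differentiable at $t=0$). Then the following are equivalent: (i) $\beta'(0)=0$; (ii) $X=G(\mu)$; (iii) $X=G(X\#_t\mu)$ for all $t\in\mathbb{R}$ (equivalently, for some $t\neq0$); (iv) $I=G(\mu_X^t)$ for all $t\in\mathbb{R}$ (equivalently, for some $t\neq0$).
   Context: $\mathbb{P}_m$ denotes the set of $m\times m$ complex positive definite matrices, with the Riemannian distance $d(A,B)=\|\log(A^{-1/2}BA^{-1/2})\|_2$, where $\|Z\|_2=(\mathrm{tr}\,Z^2)^{1/2}$. For $A,B\in\mathbb{P}_m$ and $t\in\mathbb{R}$, $A\#_tB:=A^{1/2}(A^{-1/2}BA^{-1/2})^tA^{1/2}$. $\mathcal{P}^1(\mathbb{P}_m)$ is the set of Borel probability measures $\mu$ on $\mathbb{P}_m$ with $\int_{\mathbb{P}_m}d(Z,W)\,d\mu(Z)<\infty$ for some (equivalently all) $W$. The Cartan barycenter of $\mu\in\mathcal{P}^1(\mathbb{P}_m)$ is $G(\mu)=\mathrm{arg\,min}_{Z\in\mathbb{P}_m}\int_{\mathbb{P}_m}[d^2(Z,A)-d^2(W,A)]\,d\mu(A)$ (unique, independent of the fixed $W$). $X\#_t\mu$ is the push-forward of $\mu$ under $A\mapsto X\#_tA$. $\mu_X$ is the push-forward of $\mu$ under $A\mapsto X^{-1/2}AX^{-1/2}$, and $\mu_X^t$ is the push-forward of $\mu_X$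 under $A\mapsto A^t$. $I$ is the $m\times m$ identity matrix. *)

(* Defs.v *)
From HB Require Import structures.
From mathcomp Require Import all_boot all_order all_algebra.
From mathcomp Require Import all_classical all_reals all_analysis.
From mathcomp Require Import complex.
Set Implicit Arguments. Unset Strict Implicit. Unset Printing Implicit Defensive.
Import Order.TTheory GRing.Theory Num.Theory.
Local Open Scope classical_set_scope.
Local Open Scope ring_scope.
Local Open Scope complex_scope.

Section Defs.
Variables (R : realType) (m : nat).
Local Notation C := (R[i]).
Local Notation M := ('M[C]_m).

Definition adjmx (A : 'M[C]_(m, m)) : M := (map_mx (@Num.conj C) A)^T.
Definition cadj (v : 'cV[C]_m) : 'rV[C]_m := (map_mx (@Num.conj C) v)^T.

Definition hermitian (A : M) : Prop := adjmx A = A.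
Definition posdef (A : M) : Prop :=
  hermitian A /\ forall v : 'cV[C]_m, v != 0 -> 0 < (cadj v *m A *m v) 0 0.

Definition spec_dec (A : M) (p : M * 'rV[R]_m) : Prop :=
  [/\ p.1 *m adjmx p.1 = 1%:M, (forall i, 0 < p.2 0 i) &
      A = p.1 *m diag_mx (map_mx (fun x => x%:C) p.2) *m adjmx p.1].

Definition fcalc (f : R -> R) (A : M) : M :=
  let p := xget (1%:M, const_mx 1) (spec_dec A) in
  p.1 *m diag_mx (map_mx (fun x => (f x)%:C) p.2) *m adjmx p.1.

Definition mpow (A : M) (t : R) : M := fcalc (fun x => powR x t) A.
Definition mlog (A : M) : M := fcalc (@ln R) A.

Definition rdist (A B : M) : R :=
  let L := mlog (mpow A (- (1/2)) *m B *m mpow A (- (1/2))) in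
  Num.sqrt (complex.Re (\tr (L *m L))).

Definition geomean (t : R) (A B : M) : M :=
  mpow A (1/2) *m mpow (mpow A (- (1/2)) *m B *m mpow A (- (1/2))) t *m mpow A (1/2).

Definition posdefb (A : M) : bool := `[< posdef A >].

End Defs.

Definition PD (R : realType) (m : nat) := {A : 'M[R[i]]_m | posdefb A}.

Lemma posdef1 (R : realType) (m : nat) : posdefb (1%:M : 'M[R[i]]_m).
Proof.
apply/asboolP; split.
  apply/matrixP => i j; rewrite !mxE eq_sym. case: (i == j); rewrite /= ?conjC1 ?conjC0 //.
move=> v v0; rewrite mulmx1 mxE.
have [i vi] : exists i, v i 0 != 0.
  apply/existsP; rewrite -negb_forall; apply: contra v0 => /forallP H.
  by apply/eqP/matrixP => a b; rewrite (ord1 b) mxE; exact/eqP/H.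
rewrite (bigD1 i) //= ltr_pwDl //.
  by rewrite !mxE mulrC mul_conjC_gt0.
by apply: sumr_ge0 => k _; rewrite !mxE mulrC mul_conjC_ge0.
Qed.

Definition PDone (R : realType) (m : nat) : PD R m := exist _ 1%:M (posdef1 R m).

HB.instance Definition _ (R : realType) (m : nat) :=
  SubChoice.copy (PD R m) {A : 'M[R[i]]_m | posdefb A}.
HB.instance Definition _ (R : realType) (m : nat) :=
  isPointed.Build (PD R m) (PDone R m).

(** open d-balls; they generate the Borel sigma-algebra of (P_m, d) *)
Definition rballs (R : realType) (m : nat) : set (set (PD R m)) :=
  [set S | exists (A : PD R m) (r : R), S = [set B | rdist (val A) (val B) < r]].

Definition PDm (R : realType) (m : nat) := g_sigma_algebraType (@rballs R m).

Section Push.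
Context d1 d2 (T1 : measurableType d1) (T2 : measurableType d2) (R : realType).
Variables (mu : {measure set T1 -> \bar R}) (f : T1 -> T2).
Hypothesis mf : measurable_fun [set: T1] f.
Definition pushM : {measure set T2 -> \bar R} :=
  measure_function_pushforward__canonical__measure_function_Measure mu mf.
Lemma pushME A : pushM A = pushforward mu f A. Proof. by []. Qed.
End Push.

(** push-forward of a measure on P_m under a map P_m -> P_m
    (the maps used below are continuous, hence Borel measurable, so the
    first branch is the one that is taken; the second is never used) *)
Definition push (R : realType) (m : nat) (mu : {measure set PDm R m -> \bar R})
    (f : PDm R m -> PDm R m) : {measure set PDm R m -> \bar R} :=
  match pselect (measurable_fun [set: PDm R m] f) with
  | left mf => pushM mu mf
  | right _ => mu
  end.

(** the maps A |-> X #_t A, A |-> X^{-1/2} A X^{-1/2}, A |-> A^t on P_m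
    (insubd: the result is positive definite, the default is never used) *)
Definition geoPD (R : realType) (m : nat) (X : PD R m) (t : R) (A : PDm R m) : PDm R m :=
  insubd X (geomean t (val X) (val A)).
Definition congrPD (R : realType) (m : nat) (X : PD R m) (A : PDm R m) : PDm R m :=
  insubd X (mpow (val X) (- (1/2)) *m val A *m mpow (val X) (- (1/2))).
Definition powPD (R : realType) (m : nat) (t : R) (A : PDm R m) : PDm R m :=
  insubd A (mpow (val A) t).

Local Open Scope ereal_scope.

Definition P1 (R : realType) (m : nat) (mu : {measure set PDm R m -> \bar R}) : Prop :=
  exists W : PD R m, mu.-integrable [set: PDm R m] (fun A => (rdist (val W) (val A))%:E).

(** the objective of the Cartan barycenter, with the fixed reference W = I *)
Definition cartan_obj (R : realType) (m : nat) (mu : {measure set PDm R m -> \bar R})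
    (Z : PD R m) : \bar R :=
  \int[mu]_(A in [set: PDm R m])
     (((rdist (val Z) (val A)) ^+ 2 - (rdist 1%:M (val A)) ^+ 2)%R)%:E.

(** Cartan barycenter G(mu): the (unique) minimizer of cartan_obj *)
Definition cartan (R : realType) (m : nat) (mu : {measure set PDm R m -> \bar R}) : PD R m :=
  xget (PDone R m) [set Z | forall Y : PD R m, cartan_obj mu Z <= cartan_obj mu Y].

(* Main.v *)
Require Import Defs.
From HB Require Import structures.
From mathcomp Require Import all_boot all_order all_algebra.
From mathcomp Require Import all_classical all_reals all_analysis.
From mathcomp Require Import measurable_realfun complex ring lra.
Set Implicit Arguments. Unset Strict Implicit. Unset Printing Implicit Defensive.
Import Order.TTheory GRing.Theory Num.Theory.
Import numFieldNormedType.Exports.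
Local Open Scope classical_set_scope.
Local Open Scope ring_scope.
Local Open Scope complex_scope.

(* Write <U, V> for the real Frobenius product, Lg X A = log(X^-1/2 A X^-1/2), so that
   d(X, A) = |Lg X A|, and call X balanced for mu when int <V, Lg X A> dmu(A) = 0 for
   every Hermitian V. Since Lg X (X #_t A) = t Lg X A, being balanced for X #_t mu and
   for mu are equivalent when t <> 0, and likewise for mu_X^t at I. So everything
   reduces to: X = G(mu) iff X is balanced, and beta'(0) = 0 implies X is balanced.

   The geometric input is |Lg X A - Lg X B| <= d(A, B). In eigenbases of A and B,
   tr(A^-1 B) + tr(B^-1 A) - 2m = sum w_ij (2 sinh((a_i - b_j)/2))^2 with w_ij >= 0, where
   e^a_i, e^b_j are the eigenvalues, and this dominates
   |log A - log B|^2 = sum w_ij (a_i - b_j)^2; subdividing a geodesic finely gives the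
   claim. It yields the triangle inequality and
   d(Y, A)^2 - d(X, A)^2 >= d(X, Y)^2 - 2 <Lg X Y, Lg X A>, so a balanced point is the
   unique minimizer. The same identity bounds d(A, B) above to first order, which gives
   the first variation of d^2, hence minimizers are balanced (dominated convergence).

   If beta'(0) = 0 then d(X, beta(t)) = o(t), so the minimum of the objective of X #_t mu,
   normalized to vanish at X, is at least -o(t^2). Its value at X #_t Y is
   t^2 (|V|^2 - 2 int <V, Lg X A> dmu(A)) + o(t^2) with V = Lg X Y, for arbitrary
   Hermitian V, which forces X to be balanced. *)

(** * Frobenius inner product *)

(** The real part makes this a real scalar product on complex matrices; locking keeps simplification
    from unfolding the trace. *)
HB.lock Definition ip (R : realType) (m : nat) (A B : 'M[R[i]]_m) : R :=
  complex.Re (\tr (A *m adjmx B)).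
HB.lock Definition nm (R : realType) (m : nat) (A : 'M[R[i]]_m) : R := Num.sqrt (ip A A).

Section FrobeniusProduct.
Variables (R : realType) (m : nat).
Local Notation M := ('M[R[i]]_m).
Implicit Types (A B D : M) (x : R).

Lemma ip_tr A B : ip A B = complex.Re (\tr (A *m adjmx B)).
Proof. by rewrite ip.unlock. Qed.

Lemma nmE A : nm A = Num.sqrt (ip A A).
Proof. by rewrite nm.unlock. Qed.

Lemma adjmxM A B : adjmx (A *m B) = adjmx B *m adjmx A.
Proof. by rewrite /adjmx map_mxM trmx_mul. Qed.

Lemma adjmxK A : adjmx (adjmx A) = A.
Proof. by apply/matrixP => i j; rewrite !mxE conjCK. Qed.

Lemma adjmx1 : adjmx (1%:M : M) = 1%:M.
Proof. by rewrite /adjmx map_mx1 trmx1. Qed.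

Lemma ipE A B : ip A B = \sum_i \sum_j
  (complex.Re (A i j) * complex.Re (B i j) + complex.Im (A i j) * complex.Im (B i j)).
Proof.
rewrite !ip_tr /mxtrace (raddf_sum (@complex.Re R : Rcomplex R -> R)).
apply: eq_bigr => i _; rewrite mxE (raddf_sum (@complex.Re R : Rcomplex R -> R)).
apply: eq_bigr => j _; rewrite !mxE.
by case: (A i j) => a b; case: (B i j) => c d /=; rewrite mulrN opprK.
Qed.

Lemma ipC A B : ip A B = ip B A.
Proof.
by rewrite !ipE; apply: eq_bigr => i _; apply: eq_bigr => j _; ring.
Qed.

Lemma ipDl A B D : ip (A + B) D = ip A D + ip B D.
Proof.
rewrite !ipE -big_split; apply: eq_bigr => i _; rewrite -big_split.
apply: eq_bigr => j _; rewrite !mxE.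
by case: (A i j) => a b; case: (B i j) => c d /=; ring.
Qed.

Lemma ipZl x A D : ip (x%:C *: A) D = x * ip A D.
Proof.
rewrite !ipE mulr_sumr; apply: eq_bigr => i _; rewrite mulr_sumr.
apply: eq_bigr => j _; rewrite !mxE.
by case: (A i j) => a b /=; ring.
Qed.

Lemma ipNl A D : ip (- A) D = - ip A D.
Proof.
rewrite !ipE -sumrN; apply: eq_bigr => i _; rewrite -sumrN.
apply: eq_bigr => j _; rewrite !mxE.
by case: (A i j) => a b /=; ring.
Qed.

Lemma ipDr A B D : ip D (A + B) = ip D A + ip D B.
Proof. by rewrite ipC ipDl !(ipC D). Qed.

Lemma ipZr x A D : ip D (x%:C *: A) = x * ip D A.
Proof. by rewrite ipC ipZl (ipC D). Qed.

Lemma ipNr A D : ip D (- A) = - ip D A.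
Proof. by rewrite ipC ipNl (ipC D). Qed.

Lemma ip_ge0 A : 0 <= ip A A.
Proof.
rewrite ipE; apply: sumr_ge0 => i _; apply: sumr_ge0 => j _.
by rewrite -!expr2 addr_ge0 // sqr_ge0.
Qed.

Lemma entry_le_ip A i j :
  complex.Re (A i j) ^+ 2 + complex.Im (A i j) ^+ 2 <= ip A A.
Proof.
rewrite ipE (bigD1 i) //= (bigD1 j) //= -!expr2 -addrA lerDl.
apply: addr_ge0.
  by apply: sumr_ge0 => k _; rewrite -!expr2 addr_ge0 // sqr_ge0.
by apply: sumr_ge0 => l _; apply: sumr_ge0 => k _; rewrite -!expr2 addr_ge0 // sqr_ge0.
Qed.

Lemma ip_eq0 A : ip A A = 0 -> A = 0.
Proof.
move=> A0; apply/matrixP => i j; rewrite mxE.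
have := entry_le_ip A i j; rewrite A0.
case: (A i j) => a b /= h.
have a0 : a = 0 by apply/eqP; rewrite -sqrf_eq0; apply/eqP; nra.
have b0 : b = 0 by apply/eqP; rewrite -sqrf_eq0; apply/eqP; nra.
by rewrite a0 b0.
Qed.

Lemma ip_subsq A B : ip (A - B) (A - B) = ip A A + ip B B - 2 * ip A B.
Proof. by rewrite ipDl !ipDr !ipNl !ipNr (ipC B A); move: (ip A A) (ip B B) (ip A B) => x y z; ring. Qed.

Lemma nm_ge0 A : 0 <= nm A.
Proof. by rewrite nmE sqrtr_ge0. Qed.

Lemma sqr_nm A : nm A ^+ 2 = ip A A.
Proof. by rewrite !nmE sqr_sqrtr // ip_ge0. Qed.

Lemma nm_eq0 A : nm A = 0 -> A = 0.
Proof. by move=> A0; apply: ip_eq0; rewrite -sqr_nm A0 expr0n. Qed.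

Lemma cauchy_schwarz A B : `|ip A B| <= nm A * nm B.
Proof.
suff H : ip A B ^+ 2 <= (nm A * nm B) ^+ 2.
  by rewrite -ler_sqr ?nnegrE ?mulr_ge0 ?nm_ge0 // real_normK ?num_real.
rewrite exprMn !sqr_nm.
have [B0|B0] := eqVneq (ip B B) 0.
  have : ip A ((0 : R)%:C *: B) = 0 by rewrite ipZr mul0r.
  by rewrite scale0r B0 (ip_eq0 B0) => ->; rewrite expr0n mulr0.
have Bp : 0 < ip B B by rewrite lt0r B0 ip_ge0.
have := ip_ge0 (A - (ip A B / ip B B)%:C *: B).
rewrite ip_subsq ipZl !ipZr; move: (ip A A) (ip B B) (ip A B) Bp {B0} => a b c b0 h.
have : 0 <= (a + c / b * (c / b * b) - 2 * (c / b * c)) * b by rewrite mulr_ge0 // ltW.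
rewrite (_ : _ * b = a * b - c ^+ 2) ?subr_ge0 //.
by field; rewrite gt_eqF.
Qed.

Lemma nmD A B : nm (A + B) <= nm A + nm B.
Proof.
rewrite -ler_sqr ?nnegrE ?addr_ge0 ?nm_ge0 // sqr_nm.
rewrite ipDl !ipDr (ipC B A) sqrrD !sqr_nm.
have := le_trans (ler_norm _) (cauchy_schwarz A B).
by move: (ip A A) (ip B B) (ip A B) (nm A * nm B) => a b c d; lra.
Qed.

Lemma nmZ x A : nm (x%:C *: A) = `|x| * nm A.
Proof. by rewrite !nmE ipZl ipZr mulrA -expr2 sqrtrM ?sqr_ge0 // sqrtr_sqr. Qed.

Lemma nmN A : nm (- A) = nm A.
Proof. by rewrite !nmE ipNl ipNr opprK. Qed.

Lemma nmB A B : nm (A - B) = nm (B - A).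
Proof. by rewrite -nmN opprB. Qed.

Lemma nm0 : nm (0 : M) = 0.
Proof. by have := nmZ 0 0; rewrite normr0 mul0r scaler0. Qed.

Lemma ip00 : ip (0 : M) 0 = 0.
Proof. by rewrite -sqr_nm nm0 expr0n. Qed.

Lemma nm_sum (I : Type) (r : seq I) (F : I -> M) :
  nm (\sum_(i <- r) F i) <= \sum_(i <- r) nm (F i).
Proof.
elim: r => [|i r IH]; first by rewrite !big_nil nm0.
by rewrite !big_cons; apply: le_trans (nmD _ _) _; rewrite lerD2l.
Qed.

Lemma ip_mull A B D : ip (A *m B) D = ip B (adjmx A *m D).
Proof.
by rewrite !ip_tr [adjmx (adjmx A *m D)]adjmxM adjmxK -mulmxA mxtrace_mulC mulmxA.
Qed.

Lemma ip_mulr A B D : ip (B *m A) D = ip B (D *m adjmx A).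
Proof. by rewrite !ip_tr adjmxM adjmxK mulmxA. Qed.

End FrobeniusProduct.

(** * Spectral calculus *)

(** Spectral form with eigenbasis [U] and real spectrum [a] as separate arguments, so that
    functional calculus changes only [a]. *)
HB.lock Definition sp (R : realType) (m : nat) (U : 'M[R[i]]_m) (a : 'I_m -> R) : 'M[R[i]]_m :=
  U *m diag_mx (\row_i (a i)%:C) *m adjmx U.

Section Spectral.
Variables (R : realType) (m : nat).
Local Notation M := ('M[R[i]]_m).
Implicit Types (A B D U V : M) (a b : 'I_m -> R).

Definition uni U := U *m adjmx U = 1%:M.
Lemma uniC U : uni U -> adjmx U *m U = 1%:M.
Proof. by move=> h; apply: mulmx1C. Qed.

Lemma uniM U V : uni U -> uni V -> uni (U *m V).
Proof. by rewrite /uni => hU hV; rewrite adjmxM mulmxA -(mulmxA U) hV mulmx1. Qed.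

Lemma adjmx_diag a : adjmx (diag_mx (\row_i (a i)%:C) : M) = diag_mx (\row_i (a i)%:C).
Proof.
apply/matrixP => i j; rewrite !mxE eq_sym; case: eqP => [->|_]; last by rewrite !mulr0n; exact: conjc0.
by rewrite !mulr1n; exact: conjc_real.
Qed.

Lemma eq_sp U a b : a =1 b -> sp U a = sp U b.
Proof. by move=> ab; rewrite !sp.unlock; congr (_ *m diag_mx _ *m _); apply/rowP => i; rewrite !mxE ab. Qed.

Lemma spM U a b : uni U -> sp U a *m sp U b = sp U (fun i => a i * b i).
Proof.
move=> hU; rewrite !sp.unlock !mulmxA -(mulmxA _ (adjmx U)) uniC // mulmx1.
rewrite -(mulmxA U) mulmx_diag; congr (_ *m diag_mx _ *m _).
by apply/rowP => i; rewrite !mxE rmorphM.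
Qed.

Lemma sp1 U : uni U -> sp U (fun=> 1) = 1%:M.
Proof.
move=> hU; rewrite !sp.unlock (_ : diag_mx _ = 1%:M) ?mulmx1 //.
by apply/matrixP => i j; rewrite !mxE.
Qed.

Lemma adj_sp U a : adjmx (sp U a) = sp U a.
Proof. by rewrite !sp.unlock !adjmxM adjmxK adjmx_diag mulmxA. Qed.

Lemma spZ U a (x : R) : x%:C *: sp U a = sp U (fun i => x * a i).
Proof.
rewrite !sp.unlock scalemxAl scalemxAr; congr (_ *m _ *m _).
by apply/matrixP => i j; rewrite !mxE rmorphM mulrnAr.
Qed.

Lemma spB U a b : sp U a - sp U b = sp U (fun i => a i - b i).
Proof.
rewrite !sp.unlock -mulmxBl -mulmxBr; congr (_ *m _ *m _).
by apply/matrixP => i j; rewrite !mxE rmorphB mulrnBl.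
Qed.

Lemma sp_conj U V a : V *m sp U a *m adjmx V = sp (V *m U) a.
Proof. by rewrite !sp.unlock adjmxM !mulmxA. Qed.

Lemma ip_uni U A B : uni U -> ip (U *m A *m adjmx U) (U *m B *m adjmx U) = ip A B.
Proof.
move=> hU; rewrite -mulmxA ip_mull !mulmxA uniC // mul1mx ip_mulr adjmxK.
by rewrite -mulmxA uniC // mulmx1.
Qed.

(** The weights are the squared moduli of the entries of [adjmx U *m V], the overlaps of the two
    eigenbases. They do not depend on the spectra, so one [w] serves all [a] and [b] at once. *)
Lemma ip_sp U V : uni U -> uni V -> exists w : 'I_m -> 'I_m -> R,
  (forall i j, 0 <= w i j) /\
  forall a b, ip (sp U a) (sp V b) = \sum_i \sum_j w i j * (a i * b j).
Proof.
move=> hU hV; pose W := adjmx U *m V.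
exists (fun i j => complex.Re (W i j) ^+ 2 + complex.Im (W i j) ^+ 2).
split=> [i j|a b]; first by rewrite addr_ge0 // sqr_ge0.
rewrite !sp.unlock -mulmxA ip_mull -!mulmxA ip_mulr adjmxK.
rewrite (_ : _ *m U = (W *m diag_mx (\row_i (b i)%:C)) *m adjmx W); last first.
  by rewrite /W adjmxM adjmxK !mulmxA.
rewrite -ip_mulr ipE; apply: eq_bigr => i _; apply: eq_bigr => j _.
rewrite mul_diag_mx mul_mx_diag; clearbody W; rewrite !mxE.
by case: (W i j) => x y /=; ring.
Qed.

Lemma ip_spsp U a b : uni U -> ip (sp U a) (sp U b) = \sum_i a i * b i.
Proof.
move=> hU; rewrite !sp.unlock (ip_uni _ _ hU) ipE; apply: eq_bigr => i _.
rewrite (bigD1 i) //= big1 ?addr0 => [|j ji].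
  by rewrite !mxE eqxx !mulr1n /=; ring.
by rewrite !mxE eq_sym (negbTE ji) !mulr0n /=; ring.
Qed.

(** A spectrum constantly equal to 1 gives the identity matrix in either basis, so the squared norms
    of both matrices can be written with the same weights as the cross term. *)
Lemma ip_sp_sub U V w : uni U -> uni V ->
  (forall a b, ip (sp U a) (sp V b) = \sum_i \sum_j w i j * (a i * b j)) ->
  forall a b, ip (sp U a - sp V b) (sp U a - sp V b) =
    \sum_i \sum_j w i j * (a i - b j) ^+ 2.
Proof.
move=> hU hV wE a b.
have aE : ip (sp U a) (sp U a) = \sum_i \sum_j w i j * (a i ^+ 2).
  have := wE (fun i => a i ^+ 2) (fun=> 1); rewrite (sp1 hV) -(sp1 hU) !ip_spsp //.
  under eq_bigr do rewrite mulr1 expr2.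
  by move=> ->; under eq_bigr => i _ do under eq_bigr => j _ do rewrite mulr1.
have bE : ip (sp V b) (sp V b) = \sum_i \sum_j w i j * (b j ^+ 2).
  have := wE (fun=> 1) (fun i => b i ^+ 2); rewrite (sp1 hU) -(sp1 hV) !ip_spsp //.
  under eq_bigr do rewrite mul1r expr2.
  by move=> ->; under eq_bigr => i _ do under eq_bigr => j _ do rewrite mul1r.
rewrite ip_subsq aE bE wE -big_split mulr_sumr -sumrB; apply: eq_bigr => i _.
rewrite -big_split mulr_sumr -sumrB; apply: eq_bigr => j _ /=.
by move: (w i j) (a i) (b j) => x y z; ring.
Qed.

Lemma spec_herm A : Defs.hermitian A -> exists U a, uni U /\ A = sp U a.
Proof.
move=> hA; have hsA : A \is hermsymmx.
  by apply/is_hermitianmxP; rewrite expr0 scale1r -map_trmx; exact: esym.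
have Pu := spectral_unitarymx A.
have hU : uni (adjmx (spectralmx A)).
  rewrite /uni adjmxK; apply: mulmx1C; rewrite /adjmx map_trmx; exact/unitarymxP.
exists (adjmx (spectralmx A)), (fun i => complex.Re (spectral_diag A 0 i)); split=> //.
have /hermitian_normalmx /orthomx_spectralP {1}-> := hsA.
rewrite invmx_unitary // !sp.unlock adjmxK /adjmx map_trmx; congr (_ *m diag_mx _ *m _).
apply/rowP => i; rewrite mxE RRe_real //.
by have /mxOverP := hermitian_spectral_diag_real hsA; apply.
Qed.

Lemma cV_neq0 (v : 'cV[R[i]]_m) : v != 0 -> exists i, v i 0 != 0.
Proof.
move=> v0; apply/existsP; rewrite -negb_forall; apply: contra v0 => /forallP H.
by apply/eqP/matrixP => k l; rewrite (ord1 l) mxE; exact/eqP/H.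
Qed.

Lemma posdef_sp U a : uni U -> (forall i, 0 < a i) -> posdef (sp U a).
Proof.
move=> hU ha; split; first exact: adj_sp.
move=> v v0; pose w := adjmx U *m v.
have w0 : w != 0.
  apply: contra v0 => /eqP w0; apply/eqP.
  by rewrite -[v]mul1mx -hU -mulmxA -/w w0 mulmx0.
have -> : cadj v *m sp U a *m v = cadj w *m diag_mx (\row_i (a i)%:C) *m w.
  rewrite /w !sp.unlock; have -> : cadj (adjmx U *m v) = cadj v *m U.
    by rewrite /cadj map_mxM trmx_mul -[in RHS](adjmxK U).
  by rewrite !mulmxA.
have wE i : (cadj w *m diag_mx (\row_i (a i)%:C)) 0 i * w i 0 = (a i)%:C * (w i 0 * (w i 0)^*%R).
  by rewrite mul_mx_diag !mxE; ring.
rewrite mxE; have [i wi] := cV_neq0 w0.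
rewrite (bigD1 i) //= ltr_pwDl //.
  by rewrite wE mulr_gt0 ?ltcR ?mul_conjC_gt0.
by apply: sumr_ge0 => k _; rewrite wE mulr_ge0 ?lecR ?mul_conjC_ge0 // ltW.
Qed.

Lemma spec_posdef A : posdef A -> exists U a, [/\ uni U, forall i, 0 < a i & A = sp U a].
Proof.
move=> [/spec_herm[U [a [hU eA]]] pA]; exists U, a; split=> // i.
pose v := U *m delta_mx i 0 : 'cV_m.
have Uv : adjmx U *m v = delta_mx i 0 by rewrite mulmxA uniC // mul1mx.
have v0 : v != 0.
  apply/eqP => v0; move: Uv; rewrite v0 mulmx0 => /matrixP/(_ i 0).
  by rewrite !mxE !eqxx => /eqP; rewrite eq_sym oner_eq0.
have := pA v v0; rewrite eA !sp.unlock.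
have -> : cadj v *m (U *m diag_mx (\row_i (a i)%:C) *m adjmx U) *m v =
   delta_mx 0 i *m diag_mx (\row_i (a i)%:C) *m delta_mx i 0.
  have cv : cadj v *m U = delta_mx 0 i.
    have -> : cadj v = delta_mx 0 i *m adjmx U.
      by rewrite /cadj map_mxM trmx_mul -/(adjmx U) map_delta_mx trmx_delta.
    by rewrite -mulmxA uniC // mulmx1.
  by rewrite !mulmxA cv -(mulmxA _ (adjmx U) U) uniC // mulmx1.
rewrite mul_mx_diag mxE (bigD1 i) //= big1 => [|j ji].
  by rewrite !mxE !eqxx !mulr1 mul1r addr0 ltcR.
by rewrite !mxE (negbTE ji) mulr0.
Qed.

(** Functional calculus is well defined although spectral forms are not unique: by [ip_sp_sub],
    equality forces [a i = b j] wherever [w i j] is nonzero, hence [f (a i) = f (b j)] there. *)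
Lemma sp_congr (f : R -> R) U V a b : uni U -> uni V -> sp U a = sp V b ->
  sp U (fun i => f (a i)) = sp V (fun i => f (b i)).
Proof.
move=> hU hV e; have [w [w0 wE]] := ip_sp hU hV; have sE := ip_sp_sub hU hV wE.
apply/subr0_eq/ip_eq0; rewrite sE.
have := sE a b; rewrite e subrr ip00 => /esym/eqP; rewrite psumr_eq0 => [|i _]; last first.
  by apply: sumr_ge0 => j _; rewrite mulr_ge0 // sqr_ge0.
move=> /allP h0; apply: big1 => i _; apply: big1 => j _.
have := h0 i (mem_index_enum _); rewrite psumr_eq0 => [|k _]; last by rewrite mulr_ge0 // sqr_ge0.
move=> /allP/(_ j (mem_index_enum _)); rewrite /= mulf_eq0 sqrf_eq0 subr_eq0.
by case/orP => /eqP ->; rewrite ?mul0r // subrr expr0n mulr0.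
Qed.

(** [fcalc] works with a decomposition chosen by [xget]; [sp_congr] shows that any other one gives
    the same value. *)
Lemma fcalc_sp (f : R -> R) U a : uni U -> (forall i, 0 < a i) ->
  fcalc f (sp U a) = sp U (fun i => f (a i)).
Proof.
move=> hU ha; rewrite /fcalc.
have ex : spec_dec (sp U a) (U, \row_i a i).
  split=> //= [i|]; first by rewrite mxE.
  by rewrite sp.unlock; congr (_ *m diag_mx _ *m _); apply/rowP => i; rewrite !mxE.
have := @xgetPex _ (1%:M, const_mx 1) (spec_dec (sp U a)) (ex_intro _ _ ex).
case: (xget _ _) => V b [/= hV hb eV].
pose b' i := b 0 i.
have dgE (g : R -> R) : V *m diag_mx (map_mx (fun x => (g x)%:C) b) *m adjmx V = sp V (fun i => g (b' i)).
  by rewrite sp.unlock; congr (_ *m diag_mx _ *m _); apply/rowP => i; rewrite !mxE.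
rewrite (dgE f); move: eV; rewrite (dgE id) => eV.
by symmetry; apply: (sp_congr f hU hV eV).
Qed.

Lemma posdef_conj (S T A : M) : S *m T = 1%:M -> posdef A -> posdef (S *m A *m adjmx S).
Proof.
move=> ST [hA pA]; split; first by rewrite /Defs.hermitian !adjmxM adjmxK hA mulmxA.
move=> v v0; have w0 : adjmx S *m v != 0.
  apply: contra v0 => /eqP w0; apply/eqP.
  have := congr1 (fun Z => adjmx T *m Z) w0.
  by rewrite mulmxA -adjmxM ST adjmx1 mul1mx mulmx0.
have := pA _ w0; have -> : cadj (adjmx S *m v) = cadj v *m S.
  by rewrite /cadj map_mxM trmx_mul -[in RHS](adjmxK S).
by rewrite !mulmxA.
Qed.

Lemma rdist_nm (P Q : M) (L := mlog (mpow P (- (1/2)) *m Q *m mpow P (- (1/2)))) :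
  adjmx L = L -> rdist P Q = nm L.
Proof. by move=> aL; rewrite /rdist -/L nmE ip_tr aL. Qed.

Lemma mlog_sp U (x : 'I_m -> R) : uni U -> mlog (sp U (fun i => expR (x i))) = sp U x.
Proof.
move=> hU; rewrite /mlog (fcalc_sp _ hU) => [|i]; last exact: expR_gt0.
by apply: eq_sp => i; rewrite expRK.
Qed.

Lemma mpow_sp U (x : 'I_m -> R) t : uni U ->
  mpow (sp U (fun i => expR (x i))) t = sp U (fun i => expR (t * x i)).
Proof.
move=> hU; rewrite /mpow (fcalc_sp _ hU) => [|i]; last exact: expR_gt0.
by apply: eq_sp => i; rewrite /powR gt_eqF ?expR_gt0 // expRK.
Qed.

End Spectral.

Opaque fcalc mpow mlog posdef rdist expR ln powR.

(** * Exponential metric increasing property *)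

Section ScalarInequalities.
Variable R : realType.
Implicit Types x y c : R.

Lemma le_of_le_harmonic x y c : (forall n : nat, x <= y + c / n.+1%:R) -> x <= y.
Proof.
move=> H; rewrite leNgt; apply/negP => yx.
have d0 : 0 < x - y by rewrite subr_gt0.
have c0 : 0 <= `|c| / (x - y) by rewrite divr_ge0 // ltW.
have := archi_boundP c0; set n := Num.bound _ => hn.
have := H n; apply/negP; rewrite -ltNge -ltrBrDl.
rewrite ltr_pdivrMr ?ltr0n // (le_lt_trans (ler_norm _)) //.
rewrite -ltr_pdivrMl // mulrC (lt_trans hn) // ltr_nat.
by rewrite ltnSn.
Qed.

(** This is 2 cosh x - 2 = (2 sinh(x/2))^2, which agrees with x^2 to second order at 0. *)
Definition coshm x := expR x + expR (- x) - 2.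

Lemma coshm_half x : coshm x = (expR (x / 2) - expR (- (x / 2))) ^+ 2.
Proof.
have e1 : expR (x / 2) * expR (- (x / 2)) = 1 by rewrite -expRD subrr expR0.
have e2 : expR x = expR (x / 2) * expR (x / 2) by rewrite -expRD -splitr.
have e3 : expR (- x) = expR (- (x / 2)) * expR (- (x / 2)) by rewrite -expRD -opprD -splitr.
by rewrite sqrrB e1 /coshm e2 e3 -!expr2; ring.
Qed.

(** Mean value theorem for e^y - e^-y - 2y, whose derivative is [coshm], a square. *)
Lemma sinh_ge x : 0 <= x -> 2 * x <= expR x - expR (- x).
Proof.
rewrite le_eqVlt => /orP[/eqP <-|x0]; first by rewrite mulr0 oppr0 subrr.
pose f y := expR y - expR (- y) - 2 * y.
pose f' y := expR y + expR (- y) - 2.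
have df y : y \in `]0, x[ -> is_derive y 1 f (f' y).
  move=> _; rewrite /f /f'; apply: is_derive_eq.
  by rewrite /GRing.scale /=; ring.
have cf : {within `[0, x], continuous f}.
  apply: continuous_subspaceT => y; apply: differentiable_continuous.
  by apply/derivable1_diffP; rewrite /f; apply: ex_derive.
have [c _] := MVT x0 df cf.
rewrite /f mulr0 oppr0 !addr0 subrr !subr0 => fE.
have : 0 <= f' c * x.
  rewrite mulr_ge0 ?(ltW x0) //; change (0 <= coshm c); rewrite coshm_half; exact: sqr_ge0.
by rewrite -fE subr_ge0.
Qed.

Lemma coshm_ge x : x ^+ 2 <= coshm x.
Proof.
rewrite coshm_half; wlog x0 : x / 0 <= x => [H|].
  have [/H//|/ltW x0] := leP 0 x.
  have := H (- x); rewrite oppr_ge0 => /(_ x0).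
  by rewrite sqrrN mulNr opprK -[X in _ <= X -> _]sqrrN opprB.
have := @sinh_ge (x / 2); rewrite divr_ge0 // => /(_ isT) h.
by rewrite ler_sqr ?nnegrE //; lra.
Qed.

(** For x >= 0, take square roots and divide by e^(x/2): what remains is 1 - e^-x <= x. *)
Lemma coshm_le x : coshm x <= x ^+ 2 * expR `|x|.
Proof.
wlog x0 : x / 0 <= x => [H|].
  have [/H//|/ltW x0] := leP 0 x.
  have := H (- x); rewrite oppr_ge0 sqrrN normrN => /(_ x0).
  by rewrite /coshm opprK (addrC (expR (- x))).
have e1 : expR (x / 2) * expR (- x) = expR (- (x / 2)).
  by rewrite -expRD; congr expR; rewrite {2}(splitr x); ring.
have ee : expR x = expR (x / 2) * expR (x / 2) by rewrite -expRD -splitr.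
rewrite coshm_half ger0_norm // ee -expr2 -exprMn ler_sqr ?nnegrE.
- rewrite -e1 -[X in X - _]mulr1 -mulrBr mulrC ler_pM2r ?expR_gt0 //.
  by have := expR_ge1Dx (- x); lra.
- by rewrite subr_ge0 ler_expR; lra.
- by rewrite mulr_ge0 // expR_ge0.
Qed.

Lemma expR_le_Mexp x : expR x <= 1 + x * expR x.
Proof.
have := expR_ge1Dx (- x) => h.
have : (1 - x) * expR x <= expR (- x) * expR x by rewrite ler_wpM2r ?expR_ge0.
by rewrite -expRD addNr expR0; lra.
Qed.

End ScalarInequalities.

(** * Invariance of the Riemannian distance and its comparison with differences of logarithms *)

Section RiemannianDistance.
Variables (R : realType) (m : nat).
Local Notation M := ('M[R[i]]_m).
Implicit Types (A B D S T U V P Q X : M) (a b x : 'I_m -> R).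

(** Writing the eigenvalues as exponentials makes powers, inverses and the logarithm linear in the
    exponents. *)
Lemma posdef_exp A : posdef A -> exists U x, uni U /\ A = sp U (fun i => expR (x i)).
Proof.
move=> /spec_posdef[U [a [hU a0 ->]]]; exists U, (fun i => ln (a i)); split; first exact: hU.
by apply: eq_sp => i; rewrite lnK // posrE.
Qed.

Lemma posdef_spexp U x : uni U -> posdef (sp U (fun i => expR (x i))).
Proof. by move=> hU; apply: posdef_sp => // i; exact: expR_gt0. Qed.

Lemma spexpM U x y : uni U ->
  sp U (fun i => expR (x i)) *m sp U (fun i => expR (y i)) = sp U (fun i => expR (x i + y i)).
Proof. by move=> hU; rewrite (spM _ _ hU); apply: eq_sp => i; rewrite expRD. Qed.

Lemma spexp0 U : uni U -> sp U (fun i => expR (0 : R)) = 1%:M.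
Proof. by move=> hU; rewrite -(sp1 hU); apply: eq_sp => i; rewrite expR0. Qed.

Lemma inv_spexp U x : uni U ->
  invmx (sp U (fun i => expR (x i))) = sp U (fun i => expR (- x i)).
Proof.
move=> hU; have e : sp U (fun i => expR (x i)) *m sp U (fun i => expR (- x i)) = 1%:M.
  by rewrite (spexpM _ _ hU) -(spexp0 hU); apply: eq_sp => i; rewrite subrr.
by have [uA _] := mulmx1_unit e; rewrite -[LHS]mulmx1 -e mulKmx.
Qed.

Lemma mpow_half X (h := mpow X (- (1/2))) (k := mpow X (1/2)) : posdef X ->
  [/\ adjmx h = h, adjmx k = k, h *m k = 1%:M, k *m h = 1%:M & k *m k = X].
Proof.
move=> /posdef_exp[U [x [hU eX]]]; rewrite /h /k eX !(mpow_sp _ _ hU); split.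
- exact: adj_sp.
- exact: adj_sp.
- by rewrite (spexpM _ _ hU) -(spexp0 hU); apply: eq_sp => i; congr expR; ring.
- by rewrite (spexpM _ _ hU) -(spexp0 hU); apply: eq_sp => i; congr expR; ring.
- by rewrite (spexpM _ _ hU); apply: eq_sp => i; congr expR; field.
Qed.

Lemma mpow_halfK X (h := mpow X (- (1/2))) : posdef X -> h *m X *m h = 1%:M.
Proof.
by move=> /mpow_half[_ _ hk kh kk]; rewrite -[X in _ *m X *m _]kk mulmxA hk mul1mx kh.
Qed.

Lemma mpow_posdef X t : posdef X -> posdef (mpow X t).
Proof. by move=> /posdef_exp[U [x [hU ->]]]; rewrite (mpow_sp _ _ hU); exact: posdef_spexp. Qed.

Lemma hermitian_mlog X : posdef X -> adjmx (mlog X) = mlog X.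
Proof. by move=> /posdef_exp[U [x [hU ->]]]; rewrite (mlog_sp _ hU); exact: adj_sp. Qed.

Lemma mlog_mpow X t : posdef X -> mlog (mpow X t) = t%:C *: mlog X.
Proof. by move=> /posdef_exp[U [x [hU ->]]]; rewrite (mpow_sp _ _ hU) !(mlog_sp _ hU) spZ. Qed.

Lemma mlog_inj A B : posdef A -> posdef B -> mlog A = mlog B -> A = B.
Proof.
move=> /posdef_exp[U [x [hU ->]]] /posdef_exp[V [y [hV ->]]].
rewrite (mlog_sp _ hU) (mlog_sp _ hV); exact: sp_congr.
Qed.

Lemma mlog_surj D : adjmx D = D -> exists2 A, posdef A & mlog A = D.
Proof.
move=> /spec_herm[U [x [hU ->]]]; exists (sp U (fun i => expR (x i))).
  exact: posdef_spexp.
exact: mlog_sp.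
Qed.

Lemma mlog1 : mlog (1%:M : M) = 0.
Proof.
have u1 : uni (1%:M : M) by rewrite /uni adjmx1 mulmx1.
rewrite -(spexp0 u1) (mlog_sp _ u1) -(subrr (sp 1%:M (fun=> 0))) spB.
by apply: eq_sp => i; rewrite subrr.
Qed.

Lemma mpow1 t : mpow (1%:M : M) t = 1%:M.
Proof.
have u1 : uni (1%:M : M) by rewrite /uni adjmx1 mulmx1.
by rewrite -(spexp0 u1) (mpow_sp _ _ u1); apply: eq_sp => i; rewrite mulr0.
Qed.

Lemma mlog_unitary T U : uni U -> posdef T ->
  mlog (U *m T *m adjmx U) = U *m mlog T *m adjmx U.
Proof.
move=> hU /posdef_exp[V [x [hV ->]]].
by rewrite sp_conj (mlog_sp _ hV) (mlog_sp _ (uniM hU hV)) sp_conj.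
Qed.

Lemma nm_uni U A : uni U -> nm (U *m A *m adjmx U) = nm A.
Proof. by move=> hU; rewrite !nmE ip_uni. Qed.

Lemma posdef_congr X A : posdef X -> posdef A ->
  posdef (mpow X (- (1/2)) *m A *m mpow X (- (1/2))).
Proof.
move=> /mpow_half[ah _ hk _ _] pA.
by have := posdef_conj hk pA; rewrite ah.
Qed.

Lemma rdistE P Q : posdef P -> posdef Q ->
  rdist P Q = nm (mlog (mpow P (- (1/2)) *m Q *m mpow P (- (1/2)))).
Proof.
by move=> pP pQ; apply: rdist_nm; apply: hermitian_mlog; exact: posdef_congr.
Qed.

(** With P' the image of P, the matrix P'^(-1/2) S P^(1/2) is unitary and conjugates P^(-1/2) Q
    P^(-1/2) into its counterpart for the images, so the two logarithms have the same norm. *)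
Lemma rdist_conj S T P Q : S *m T = 1%:M -> posdef P -> posdef Q ->
  rdist (S *m P *m adjmx S) (S *m Q *m adjmx S) = rdist P Q.
Proof.
move=> ST pP pQ; have pP' := posdef_conj ST pP; have pQ' := posdef_conj ST pQ.
rewrite (rdistE pP' pQ') (rdistE pP pQ).
have hT := posdef_congr pP pQ; have hPh := mpow_halfK pP'.
have [ah' _ _ _ _] := mpow_half pP'; have [ah ak hk kh kk] := mpow_half pP.
move: ah' ah ak hk kh kk hT hPh.
set h' := mpow (S *m P *m adjmx S) _; set h := mpow P (- _); set k := mpow P _.
move: h' h k => h' h k ah' ah ak hk kh kk hT hPh.
have hW : uni (h' *m S *m k).
  rewrite /uni !adjmxM ah' ak !mulmxA -(mulmxA _ k k) kk.
  by rewrite -hPh !mulmxA.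
rewrite -(nm_uni (mlog (h *m Q *m h)) hW) -(mlog_unitary hW hT).
congr (nm (mlog _)); rewrite !adjmxM ah' ak !mulmxA.
by rewrite -(mulmxA _ k h) kh mulmx1 -(mulmxA _ h k) hk mulmx1.
Qed.

(** For T = P^(-1/2) Q P^(-1/2), the matrix W = Q^(-1/2) P^(1/2) T^(1/2) is unitary and conjugates
    T^-1 into Q^(-1/2) P Q^(-1/2). Swapping P and Q thus only negates the exponents. *)
Lemma rdist_sym P Q : posdef P -> posdef Q -> rdist P Q = rdist Q P.
Proof.
move=> pP pQ; rewrite (rdistE pP pQ) (rdistE pQ pP).
have [ah ak hk kh kk] := mpow_half pP; have [ah' ak' hk' kh' kk'] := mpow_half pQ.
have pT := posdef_congr pP pQ; have hQh := mpow_halfK pQ.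
move: ah ak hk kh kk ah' ak' hk' kh' kk' pT hQh.
set h := mpow P (- _); set k := mpow P (1/2); set h' := mpow Q (- _); set k' := mpow Q (1/2).
move: h k h' k' => h k h' k' ah ak hk kh kk ah' ak' hk' kh' kk' pT hQh.
have [U [x [hU eT]]] := posdef_exp pT.
have aT s : adjmx (sp U (fun i => expR (s * x i))) = sp U (fun i => expR (s * x i)) by exact: adj_sp.
have TT s t : sp U (fun i => expR (s * x i)) *m sp U (fun i => expR (t * x i)) =
    sp U (fun i => expR ((s + t) * x i)).
  by rewrite (spexpM _ _ hU); apply: eq_sp => i; rewrite mulrDl.
have T1 : sp U (fun i => expR (1 * x i)) = h *m Q *m h.
  by rewrite eT; apply: eq_sp => i; rewrite mul1r.
have hW : uni (h' *m k *m sp U (fun i => expR ((1 / 2) * x i))).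
  rewrite /uni !adjmxM ah' ak aT !mulmxA -(mulmxA _ (sp _ _) (sp _ _)) TT -splitr T1.
  rewrite !mulmxA -(mulmxA _ k h) kh mulmx1 -(mulmxA _ h k) hk mulmx1.
  by rewrite -hQh.
have pT' : posdef (sp U (fun i => expR (- 1 * x i))) by exact: posdef_spexp.
have -> : h' *m P *m h' = (h' *m k *m sp U (fun i => expR ((1 / 2) * x i))) *m
  sp U (fun i => expR (- 1 * x i)) *m adjmx (h' *m k *m sp U (fun i => expR ((1 / 2) * x i))).
  rewrite !adjmxM ah' ak aT !mulmxA -(mulmxA _ (sp _ _) (sp _ _)) TT.
  rewrite -(mulmxA _ (sp _ _) (sp _ _)) TT.
  rewrite (_ : 1 / 2 + _ = 0); last by field.
  rewrite (_ : sp _ _ = 1%:M) ?mulmx1; last first.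
    by rewrite -(spexp0 hU); apply: eq_sp => i; rewrite mul0r.
  by rewrite -(mulmxA _ k k) kk.
rewrite (mlog_unitary hW pT') (nm_uni _ hW) eT !(mlog_sp _ hU).
by rewrite !nmE !(ip_spsp _ _ hU); congr (Num.sqrt _); apply: eq_bigr => i _; ring.
Qed.

(* Comparison functional: D2 = sum (2 sinh(l_i/2))^2 over the eigenvalues e^l_i
   of A^-1 B, so that it agrees with d(A,B)^2 to second order. *)
Definition D2 A B : R := ip (invmx A) B + ip (invmx B) A - 2 * m%:R.

Lemma entry_le_nm U x i : uni U -> `|x i| <= nm (sp U x).
Proof.
move=> hU; rewrite -ler_sqr ?nnegrE ?nm_ge0 // sqr_nm (ip_spsp _ _ hU) real_normK ?num_real //.
rewrite (bigD1 i) //= expr2 lerDl; apply: sumr_ge0 => j _; rewrite -expr2; exact: sqr_ge0.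
Qed.

Lemma D2_bounds A B : posdef A -> posdef B ->
  ip (mlog A - mlog B) (mlog A - mlog B) <= D2 A B /\
  D2 A B <= ip (mlog A - mlog B) (mlog A - mlog B) * expR (nm (mlog A) + nm (mlog B)).
Proof.
move=> /posdef_exp[U [x [hU ->]]] /posdef_exp[V [y [hV ->]]].
rewrite (mlog_sp _ hU) (mlog_sp _ hV); have [w [w0 wE]] := ip_sp hU hV.
rewrite (ip_sp_sub hU hV wE).
have -> : D2 (sp U (fun i => expR (x i))) (sp V (fun i => expR (y i))) =
    \sum_i \sum_j w i j * coshm (x i - y j).
  (* The weights sum to <I, I> = m, which spreads the constant 2m of [D2] over the pairs (i, j). *)
  have mE : m%:R = \sum_i \sum_j w i j.
    transitivity (ip (sp U (fun=> 1)) (sp V (fun=> 1))).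
      rewrite (sp1 hV) -(sp1 hU) (ip_spsp _ _ hU).
      by rewrite (eq_bigr (fun=> 1)) ?sumr_const ?card_ord // => i _; rewrite mulr1.
    by rewrite wE; under eq_bigr => i _ do under eq_bigr => j _ do rewrite !mulr1.
  rewrite /D2 (inv_spexp _ hU) (inv_spexp _ hV) (ipC (sp V _)) !wE mE mulr_sumr -big_split -sumrB.
  apply: eq_bigr => i _; rewrite mulr_sumr -big_split -sumrB; apply: eq_bigr => j _ /=.
  rewrite -!expRD /coshm opprB (addrC (- x i)).
  by move: (w i j) (expR _) (expR _) => p q r; ring.
split.
  apply: ler_sum => i _; apply: ler_sum => j _; rewrite ler_wpM2l //; exact: coshm_ge.
rewrite mulr_suml; apply: ler_sum => i _; rewrite mulr_suml; apply: ler_sum => j _.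
rewrite -mulrA ler_wpM2l // (le_trans (coshm_le _)) // ler_wpM2l ?sqr_ge0 // ler_expR.
rewrite (le_trans (ler_normB _ _)) // lerD //; exact: entry_le_nm.
Qed.

(** The curve is P^(1/2) T^t P^(1/2) with T = P^(-1/2) Q P^(-1/2), and [x] lists the logarithms of
    the eigenvalues of T. Since c(s)^-1 c(t) is similar to T^(t-s), [D2] along the curve depends
    only on t - s. *)
Lemma geodesic P Q : posdef P -> posdef Q ->
  exists (c : R -> M) (x : 'I_m -> R), [/\ c 0 = P, c 1 = Q, forall t, posdef (c t),
    rdist P Q ^+ 2 = \sum_i x i ^+ 2 &
    forall s t, D2 (c s) (c t) = \sum_i coshm ((t - s) * x i)].
Proof.
move=> pP pQ; move: (mpow_half pP) (posdef_congr pP pQ) (rdistE pP pQ).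
set h := mpow P (- _); set k := mpow P (1/2); move: h k => h k [ah ak hk kh kk] pT dE.
have [U [x [hU eT]]] := posdef_exp pT.
pose e t := sp U (fun i => expR (t * x i)).
have e0 : e 0 = 1%:M by rewrite -(spexp0 hU); apply: eq_sp => i; rewrite mul0r.
have pe t : posdef (k *m e t *m k).
  by have := posdef_conj kh (posdef_spexp (fun i => t * x i) hU); rewrite ak.
have inv t : invmx (k *m e t *m k) = h *m e (- t) *m h.
  have E : k *m e t *m k *m (h *m e (- t) *m h) = 1%:M.
    rewrite !mulmxA -(mulmxA _ k h) kh mulmx1 -(mulmxA _ (e _) (e _)) /e (spexpM _ _ hU).
    rewrite (_ : sp _ _ = 1%:M) ?mulmx1 ?kh //.
    by rewrite -(spexp0 hU); apply: eq_sp => i; congr expR; ring.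
  by have [uA _] := mulmx1_unit E; rewrite -[LHS]mulmx1 -E mulKmx.
have ipe s t : ip (invmx (k *m e s *m k)) (k *m e t *m k) = \sum_i expR ((t - s) * x i).
  rewrite inv -mulmxA ip_mull ah !mulmxA hk mul1mx ip_mulr ah -mulmxA kh mulmx1.
  rewrite /e (ip_spsp _ _ hU); apply: eq_bigr => i _; rewrite -expRD; congr expR; ring.
exists (fun t => k *m e t *m k), x; split=> //.
- by rewrite e0 mulmx1.
- rewrite (_ : e 1 = h *m Q *m h); last by rewrite eT; apply: eq_sp => i; rewrite mul1r.
  by rewrite !mulmxA kh mul1mx -mulmxA hk mulmx1.
- by rewrite dE eT (mlog_sp _ hU) sqr_nm (ip_spsp _ _ hU); apply: eq_bigr => i _; rewrite expr2.
have mE : m%:R = \sum_(i < m) 1 :> R by rewrite sumr_const card_ord.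
move=> s t; rewrite /D2 !ipe mE mulr_sumr -big_split -sumrB.
by apply: eq_bigr => i _; rewrite /coshm /= mulr1 -mulNr opprB.
Qed.

Lemma rdist_ge0 P Q : 0 <= rdist P Q.
Proof. exact: sqrtr_ge0. Qed.

(* Exponential metric increasing property: subdivide the geodesic into n+1 arcs and
   compare log-distance with D2 on each arc; the error is second order in 1/n. *)
Lemma emi1 P Q : posdef P -> posdef Q -> nm (mlog P - mlog Q) <= rdist P Q.
Proof.
move=> pP pQ; have [c [x [c0 c1 pc dE DE]]] := geodesic pP pQ.
set d := rdist P Q in dE *; have d0 : 0 <= d by exact: rdist_ge0.
have xd i : `|x i| <= d.
  rewrite -ler_sqr ?nnegrE // dE real_normK ?num_real // (bigD1 i) //= lerDl.
  by apply: sumr_ge0 => j _; exact: sqr_ge0.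
(* The N arcs contribute at most d e^(d/N) in total, and e^(d/N) <= 1 + (d/N) e^d; this is the
   source of the constant. *)
apply: (@le_of_le_harmonic _ _ _ (d * (d * expR d))) => n.
pose N : R := n.+1%:R; have N0 : 0 < N by rewrite ltr0n.
have N1 : 1 <= N by rewrite ler1n.
have step k : nm (mlog (c (k%:R / N)) - mlog (c (k.+1%:R / N))) <= d / N * expR (d / N).
  rewrite -ler_sqr ?nnegrE ?nm_ge0 ?mulr_ge0 ?expR_ge0 ?invr_ge0 ?(ltW N0) // sqr_nm.
  apply: le_trans (D2_bounds (pc _) (pc _)).1 _; rewrite DE.
  rewrite -mulrBl -natr1 addrAC subrr add0r mul1r exprMn.
  have -> : (d / N) ^+ 2 = \sum_i (N^-1 * x i) ^+ 2.
    by rewrite exprMn dE mulr_suml; apply: eq_bigr => i _; rewrite exprMn mulrC.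
  rewrite mulr_suml; apply: ler_sum => i _; apply: le_trans (coshm_le _) _.
  rewrite ler_wpM2l ?sqr_ge0 // expr2 -expRD ler_expR normrM gtr0_norm ?invr_gt0 //.
  have h : N^-1 * `|x i| <= d / N by rewrite mulrC ler_wpM2r ?invr_ge0 ?(ltW N0).
  by rewrite (le_trans h) // lerDl divr_ge0 // ltW.
have tele : nm (mlog P - mlog Q) <= \sum_(0 <= k < n.+1) d / N * expR (d / N).
  have -> : mlog P - mlog Q = \sum_(0 <= k < n.+1) (mlog (c (k%:R / N)) - mlog (c (k.+1%:R / N))).
    rewrite -[RHS]opprK -sumrN (eq_bigr (fun k => mlog (c (k.+1%:R / N)) - mlog (c (k%:R / N)))).
      by rewrite telescope_sumr // mul0r divff ?gt_eqF // c0 c1 opprB.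
    by move=> k _; rewrite opprB.
  by apply: le_trans (nm_sum _ _) _; apply: ler_sum.
apply: le_trans tele _; rewrite sumr_const_nat subn0.
rewrite (_ : _ *+ n.+1 = d * expR (d / N)); last first.
  by rewrite -mulr_natr -/N; move: (expR _) => e; field; rewrite gt_eqF.
have dN : d / N <= d by rewrite ler_pdivrMr // ler_peMr.
apply: (@le_trans _ _ (d * (1 + d / N * expR (d / N)))).
  by rewrite ler_wpM2l // expR_le_Mexp.
rewrite mulrDr mulr1 lerD2l -[leRHS]mulrA ler_wpM2l // mulrAC ler_wpM2r ?invr_ge0 ?(ltW N0) //.
by rewrite ler_wpM2l // ler_expR.
Qed.

Lemma rdist_le1 P Q : posdef P -> posdef Q ->
  rdist P Q <= expR ((nm (mlog P) + nm (mlog Q)) / 2) * nm (mlog P - mlog Q).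
Proof.
move=> pP pQ; have [c [x [c0 c1 pc dE DE]]] := geodesic pP pQ.
rewrite -ler_sqr ?nnegrE ?rdist_ge0 ?mulr_ge0 ?expR_ge0 ?nm_ge0 // dE.
apply: (@le_trans _ _ (D2 P Q)).
  by rewrite -c0 -c1 DE; apply: ler_sum => i _; rewrite subr0 mul1r; exact: coshm_ge.
apply: le_trans (D2_bounds pP pQ).2 _.
by rewrite exprMn sqr_nm [X in _ <= X * _]expr2 -expRD -splitr mulrC.
Qed.

Lemma rdist_mpow T r : posdef T -> rdist (mpow T r) T = `|1 - r| * nm (mlog T).
Proof.
move=> pT; rewrite (rdistE (mpow_posdef r pT) pT).
have [U [x [hU ->]]] := posdef_exp pT.
rewrite !(mpow_sp _ _ hU) !(spexpM _ _ hU) !(mlog_sp _ hU) -nmZ spZ; congr nm.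
by apply: eq_sp => i; field.
Qed.

End RiemannianDistance.

(** * Geometry of the positive definite cone *)

HB.lock Definition dist (R : realType) (m : nat) (A B : PD R m) : R := rdist (val A) (val B).
(** Riemannian logarithm at X, read in the tangent space at I through congruence by X^(-1/2). *)
HB.lock Definition Lg (R : realType) (m : nat) (X A : PD R m) : 'M[R[i]]_m :=
  mlog (mpow (val X) (- (1/2)) *m val A *m mpow (val X) (- (1/2))).

Section PDGeometry.
Variables (R : realType) (m : nat).
Local Notation M := ('M[R[i]]_m).
Local Notation T := (PD R m).
Implicit Types (X Y Z A B : T) (D V : M) (t : R).

Lemma PD_posdef A : posdef (val A).
Proof. by have /asboolP := valP A. Qed.

Lemma val_PD_insubd A (P : M) : posdef P -> val (insubd A P : T) = P.
Proof. by move=> pP; rewrite val_insubd; have -> : posdefb P by exact/asboolP. Qed.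

Lemma Lg_posdef X A :
  posdef (mpow (val X) (- (1/2)) *m val A *m mpow (val X) (- (1/2))).
Proof. exact: posdef_congr (PD_posdef X) (PD_posdef A). Qed.

Lemma dist_Lg X A : dist X A = nm (Lg X A).
Proof. by rewrite dist.unlock Lg.unlock; exact: rdistE (PD_posdef X) (PD_posdef A). Qed.

Lemma dist_ge0 A B : 0 <= dist A B.
Proof. by rewrite dist.unlock; exact: rdist_ge0. Qed.

Lemma Lg_herm X A : adjmx (Lg X A) = Lg X A.
Proof. by rewrite Lg.unlock; exact: hermitian_mlog (Lg_posdef X A). Qed.

Lemma dist_sym A B : dist A B = dist B A.
Proof. by rewrite dist.unlock; exact: rdist_sym (PD_posdef A) (PD_posdef B). Qed.

Lemma Lg_refl X : Lg X X = 0.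
Proof. by rewrite Lg.unlock (mpow_halfK (PD_posdef X)) mlog1. Qed.

Lemma dist_refl X : dist X X = 0.
Proof. by rewrite dist_Lg Lg_refl nm0. Qed.

Lemma Lg_eq0 X A : Lg X A = 0 -> X = A.
Proof.
rewrite Lg.unlock -(mlog1 R m) => /(mlog_inj (Lg_posdef X A)) e; apply: val_inj.
have p1 : posdef (1%:M : M) by apply/asboolP; exact: posdef1.
move: (e p1) (mpow_half (PD_posdef X)); set h := mpow _ _; set k := mpow _ (1/2).
move: h k => h k hAh [ah ak hk kh <-].
have := congr1 (fun D => k *m D *m k) hAh.
rewrite mulmx1 => <-.
by rewrite !mulmxA kh mul1mx -(mulmxA _ h k) hk mulmx1.
Qed.

Lemma dist_eq0 X A : dist X A = 0 -> X = A.
Proof. by rewrite dist_Lg => /nm_eq0; exact: Lg_eq0. Qed.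

Lemma Lg_surj X D : adjmx D = D -> exists A, Lg X A = D.
Proof.
move=> /mlog_surj[E pE eD]; move: (mpow_half (PD_posdef X)) => [ah ak hk kh kk].
have pA : posdef (mpow (val X) (1/2) *m E *m mpow (val X) (1/2)).
  by have := posdef_conj kh pE; rewrite ak.
exists (insubd X (mpow (val X) (1/2) *m E *m mpow (val X) (1/2))).
rewrite Lg.unlock (val_PD_insubd X pA) -eD; congr mlog; move: hk kh.
set h := mpow _ (- _); set k := mpow _ _; move: h k => h k hk kh.
by rewrite !mulmxA hk mul1mx -mulmxA kh mulmx1.
Qed.

Lemma dist_congr X A B :
  rdist (mpow (val X) (- (1/2)) *m val A *m mpow (val X) (- (1/2)))
    (mpow (val X) (- (1/2)) *m val B *m mpow (val X) (- (1/2))) = dist A B.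
Proof.
have [ah _ hk _ _] := mpow_half (PD_posdef X).
by have := rdist_conj hk (PD_posdef A) (PD_posdef B); rewrite ah dist.unlock.
Qed.

(** Congruence by X^(-1/2) is an isometry that turns logarithms at X into plain ones, so [emi1]
    applies. *)
Lemma emi X A B : nm (Lg X A - Lg X B) <= dist A B.
Proof. by rewrite -(dist_congr X) Lg.unlock; exact: emi1 (Lg_posdef X A) (Lg_posdef X B). Qed.

Lemma dist_le X A B :
  dist A B <= expR ((dist X A + dist X B) / 2) * nm (Lg X A - Lg X B).
Proof.
rewrite -(dist_congr X) !dist_Lg Lg.unlock; exact: rdist_le1 (Lg_posdef X A) (Lg_posdef X B).
Qed.

(** Triangle inequality for the norm in the tangent space at A, where the difference of the
    logarithms of Z and B is controlled by [emi]. *)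
Lemma dist_triangle B A Z : dist A Z <= dist A B + dist B Z.
Proof.
rewrite (dist_sym B) (dist_Lg A Z) (dist_Lg A B).
rewrite -[Lg A Z](subrK (Lg A B)) addrC.
apply: le_trans (nmD _ _) _; rewrite lerD2l; exact: emi.
Qed.

Lemma congr_geoPD X t A :
  mpow (val X) (- (1/2)) *m val (geoPD X t A : T) *m mpow (val X) (- (1/2)) =
  mpow (mpow (val X) (- (1/2)) *m val A *m mpow (val X) (- (1/2))) t.
Proof.
have [ah ak hk kh kk] := mpow_half (PD_posdef X).
have pT := mpow_posdef t (Lg_posdef X A).
have pG : posdef (geomean t (val X) (val A)).
  by have := posdef_conj kh pT; rewrite ak.
rewrite /geoPD (val_PD_insubd X pG) /geomean.
move: hk kh; set E := mpow (_ *m _) t; set h := mpow (val X) (- _); set k := mpow (val X) _.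
move: E h k => E h k hk kh.
by rewrite !mulmxA hk mul1mx -mulmxA kh mulmx1.
Qed.

Lemma Lg_geoPD X t A : Lg X (geoPD X t A) = t%:C *: Lg X A.
Proof. by rewrite Lg.unlock congr_geoPD; exact: mlog_mpow (Lg_posdef X A). Qed.

Lemma dist_geoPDr X t A : dist (geoPD X t A) A = `|1 - t| * dist X A.
Proof.
rewrite -(dist_congr X) congr_geoPD (rdist_mpow _ (Lg_posdef X A)).
by rewrite dist_Lg Lg.unlock.
Qed.

Lemma Lg_one A : Lg (PDone R m) A = mlog (val A).
Proof. by rewrite Lg.unlock /= mpow1 mul1mx mulmx1. Qed.

Lemma val_congrPD X A :
  val (congrPD X A : T) = mpow (val X) (- (1/2)) *m val A *m mpow (val X) (- (1/2)).
Proof. exact: val_PD_insubd (Lg_posdef X A). Qed.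

Lemma Lg_congrPD X A : Lg (PDone R m) (congrPD X A) = Lg X A.
Proof. by rewrite Lg_one val_congrPD Lg.unlock. Qed.

Lemma Lg_powPD t A : Lg (PDone R m) (powPD t A) = t%:C *: Lg (PDone R m) A.
Proof.
rewrite !Lg_one /powPD (val_PD_insubd _ (mpow_posdef t (PD_posdef A))).
exact: mlog_mpow (PD_posdef A).
Qed.

(* hm identifies arbitrary real matrices with Hermitian ones; pe below is exp of hm. *)
Definition hm (B : 'M[R]_m) : M :=
  \matrix_(i, j) Complex (B i j + B j i) (B i j - B j i).

Lemma hm_herm (B : 'M[R]_m) : adjmx (hm B) = hm B.
Proof.
apply/matrixP => i j; rewrite !mxE; apply/eqP; rewrite eq_complex /=.
by rewrite addrC eqxx opprB eqxx.
Qed.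

Lemma hm_surj D : adjmx D = D -> exists2 B : 'M[R]_m, hm B = D & forall i j, `|B i j| <= nm D.
Proof.
(* For Hermitian D the real part is symmetric and the imaginary part antisymmetric, so half their
   sum separates again under B + B^T and B - B^T. *)
move=> aD; pose B : 'M[R]_m := \matrix_(i, j) ((complex.Re (D i j) + complex.Im (D i j)) / 2).
have D_le i j : `|complex.Re (D i j)| <= nm D /\ `|complex.Im (D i j)| <= nm D.
  have h := entry_le_ip D i j.
  have a0 := sqr_ge0 (complex.Re (D i j)); have b0 := sqr_ge0 (complex.Im (D i j)).
  split; rewrite -ler_sqr ?nnegrE ?nm_ge0 // real_normK ?num_real // sqr_nm; lra.
exists B => [|i j]; last first.
  have [h1 h2] := D_le i j; rewrite mxE normrM [`|2^-1|]gtr0_norm ?invr_gt0 // ler_pdivrMr //.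
  by apply: le_trans (ler_normD _ _) _; lra.
apply/matrixP => i j; rewrite !mxE; have := congr1 (fun Z : M => Z j i) aD.
rewrite !mxE; case: (D i j) => a b; case: (D j i) => c d e.
have {e} /eqP : (a -i* b)%C = (c +i* d)%C by exact: e.
rewrite eq_complex /= => /andP[/eqP <- /eqP <-].
by congr Complex; field.
Qed.

Lemma nm_hm_le (B B' : 'M[R]_m) e : 0 <= e -> (forall i j, `|B i j - B' i j| <= e) ->
  nm (hm B - hm B') <= 3 * m%:R * e.
Proof.
move=> e0 he; rewrite -ler_sqr ?nnegrE ?nm_ge0 ?mulr_ge0 // sqr_nm ipE.
apply: (@le_trans _ _ (\sum_(i < m) \sum_(j < m) (8 * e ^+ 2))).
  apply: ler_sum => i _; apply: ler_sum => j _; rewrite !mxE /=.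
  have := he i j; have := he j i; rewrite !ler_norml => /andP[h1 h2] /andP[h3 h4].
  move: (B i j) (B j i) (B' i j) (B' j i) h1 h2 h3 h4 => a b c d h1 h2 h3 h4.
  rewrite -!expr2.
  have -> : (a + b - (c + d)) ^+ 2 + (a - b - (c - d)) ^+ 2 = 2 * (a - c) ^+ 2 + 2 * (b - d) ^+ 2 by ring.
  have k1 : (a - c) ^+ 2 <= e ^+ 2 by nra.
  have k2 : (b - d) ^+ 2 <= e ^+ 2 by nra.
  by have := sqr_ge0 e; lra.
rewrite !sumr_const card_ord -mulrnA -[leLHS]mulr_natr natrM.
have := sqr_ge0 (m%:R * e); rewrite !expr2; move: (m%:R) => M; nra.
Qed.

Definition pe (B : 'M[R]_m) : T := xget (PDone R m) [set A | Lg (PDone R m) A = hm B].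

Lemma Lg_pe (B : 'M[R]_m) : Lg (PDone R m) (pe B) = hm B.
Proof.
have [A hA] := Lg_surj (PDone R m) (hm_herm B).
exact: (@xgetPex _ (PDone R m) [set A | Lg (PDone R m) A = hm B] (ex_intro _ A hA)).
Qed.

Lemma pe_surj A : exists2 B : 'M[R]_m, pe B = A & forall i j, `|B i j| <= dist (PDone R m) A.
Proof.
have [B hB Bd] := hm_surj (Lg_herm (PDone R m) A); exists B; last by rewrite dist_Lg.
apply: dist_eq0; apply/eqP; rewrite eq_le dist_ge0 andbT.
by apply: le_trans (dist_le (PDone R m) _ _) _; rewrite Lg_pe hB subrr nm0 mulr0.
Qed.

Lemma pe_continuous (B : 'M[R]_m) e : 0 < e -> exists2 r, 0 < r &
  forall B' : 'M[R]_m, (forall i j, `|B i j - B' i j| <= r) -> dist (pe B) (pe B') < e.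
Proof.
move=> e0; pose N : R := 3 * m%:R + 1; have N0 : 0 < N by rewrite ltr_wpDl.
pose a := nm (hm B); have a0 : 0 <= a by exact: nm_ge0.
pose E := expR (a + 1); have E0 : 0 < E by exact: expR_gt0.
(* The first bound keeps |hm B'| <= a + 1, so the exponential factor of [dist_le] is at most E; the
   second makes the product E N r at most e/2. *)
exists (Num.min (1 / N) (e / (2 * N * E))).
  by rewrite lt_min !divr_gt0 ?mulr_gt0.
move=> B' hB'; set r := Num.min _ _ in hB'.
have r0 : 0 <= r by rewrite le_min !divr_ge0 ?mulr_ge0 // ltW.
have r1 : N * r <= 1 by rewrite mulrC -ler_pdivlMr // ge_min lexx.
have r2 : 2 * N * E * r <= e.
  by rewrite mulrC -ler_pdivlMr ?mulr_gt0 // ge_min lexx orbT.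
have hN : nm (hm B - hm B') <= N * r.
  by apply: le_trans (nm_hm_le r0 hB') _; rewrite ler_wpM2r // lerDl.
have hB1 : nm (hm B') <= a + 1.
  rewrite -[hm B'](subrK (hm B)) addrC; apply: le_trans (nmD _ _) _.
  by rewrite lerD2l nmB; apply: le_trans hN _.
apply: le_lt_trans (dist_le (PDone R m) _ _) _; rewrite !dist_Lg !Lg_pe.
apply: (@le_lt_trans _ _ (E * (N * r))).
  by rewrite ler_pM ?expR_ge0 ?nm_ge0 // ler_expR -/a; lra.
have : 0 <= E * (N * r) by rewrite !mulr_ge0 // ltW.
by move: r2 e0; rewrite -(mulrA 2) -(mulrA 2) [N * E]mulrC -(mulrA E); move: (E * (N * r)) => y; lra.
Qed.

(** Local comparison with the Frobenius norm: it turns entrywise convergence to X into metric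
    convergence at the same rate. *)
Lemma dist_le_nm X : exists2 c, 0 < c & forall Y,
  c * nm (val Y - val X) <= 1 / 2 -> dist X Y <= 2 * (c * nm (val Y - val X)).
Proof.
have [U [x [hU eX]]] := posdef_exp (PD_posdef X).
have eh : mpow (val X) (- (1/2)) = sp U (fun i => expR (- (1/2) * x i)).
  by rewrite eX (mpow_sp _ _ hU).
pose s i := expR (- (1/2) * x i).
(* C dominates every eigenvalue of X^(-1/2); the summand 1 keeps it positive even for m = 0. *)
pose C := 1 + \sum_i s i; have s0 i : 0 < s i by exact: expR_gt0.
have sC i : s i <= C.
  rewrite /C (bigD1 i) //= addrCA lerDl addr_ge0 //.
  by apply: sumr_ge0 => j _; rewrite ltW.
have C0 : 0 < C by rewrite ltr_pwDl // sumr_ge0 // => i _; rewrite ltW.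
have cE D : nm (sp U s *m D *m sp U s) <= C * C * nm D.
  pose W := adjmx U *m D *m U.
  have -> : nm D = nm W.
    have uU : uni (adjmx U) by rewrite /uni adjmxK; exact: uniC.
    by rewrite -(nm_uni D uU) adjmxK.
  have -> : nm (sp U s *m D *m sp U s) =
      nm (diag_mx (\row_i (s i)%:C) *m W *m diag_mx (\row_i (s i)%:C)).
    by rewrite -[RHS](nm_uni _ hU) /W sp.unlock; congr nm; rewrite !mulmxA.
  rewrite -ler_sqr ?nnegrE ?nm_ge0 ?mulr_ge0 ?nm_ge0 ?(ltW C0) // exprMn !sqr_nm !ipE.
  rewrite mulr_sumr; apply: ler_sum => i _; rewrite mulr_sumr; apply: ler_sum => j _.
  rewrite mul_diag_mx mul_mx_diag; clearbody W; rewrite !mxE.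
  case: (W i j) => a b /=; rewrite !(mul0r, mulr0, subr0, addr0, add0r).
  have h : (s i * s j) ^+ 2 <= (C * C) ^+ 2.
    by rewrite ler_sqr ?nnegrE ?mulr_ge0 ?(ltW (s0 _)) ?(ltW C0) // ler_pM // ?(ltW (s0 _)).
  have -> : s i * a * s j * (s i * a * s j) + s i * b * s j * (s i * b * s j) =
     (s i * s j) ^+ 2 * (a * a + b * b) by ring.
  by rewrite ler_wpM2r // -!expr2 addr_ge0 // sqr_ge0.
exists (C * C); first exact: mulr_gt0.
move=> Y hY; rewrite dist_Lg Lg.unlock.
set Q := _ *m _ *m _; have pQ : posdef Q := Lg_posdef X Y.
have EQ : nm (Q - 1%:M) <= C * C * nm (val Y - val X).
  rewrite -(mpow_halfK (PD_posdef X)) /Q eh -mulmxBl -mulmxBr; exact: cE.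
have {hY} := le_trans EQ hY; move: EQ; set e := nm (Q - _) => EQ he.
suff h : nm (mlog Q) <= 2 * e by apply: le_trans h _; rewrite ler_pM2l.
have [V [y [hV eQ]]] := posdef_exp pQ.
have e2 : e ^+ 2 = \sum_i (expR (y i) - 1) ^+ 2.
  rewrite sqr_nm -(sp1 hV) eQ spB (ip_spsp _ _ hV).
  by apply: eq_bigr => i _; rewrite expr2.
have e0 : 0 <= e by exact: nm_ge0.
clearbody e; rewrite eQ (mlog_sp _ hV) -ler_sqr ?nnegrE ?mulr_ge0 ?nm_ge0 //.
rewrite sqr_nm (ip_spsp _ _ hV) exprMn e2 mulr_sumr; apply: ler_sum => i _.
rewrite -expr2; have yi : `|expR (y i) - 1| <= 1 / 2.
  apply: le_trans he; rewrite -ler_sqr ?nnegrE // e2 real_normK ?num_real //.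
  by rewrite (bigD1 i) //= lerDl; apply: sumr_ge0 => j _; exact: sqr_ge0.
(* With q = e^y this reads y^2 <= q + 1/q - 2 = (q - 1)^2 / q, which is at most 4 (q - 1)^2 because
   q >= 1/2. *)
apply: le_trans (coshm_ge _) _; rewrite /coshm expRN.
move: yi; rewrite ler_norml => /andP[y1 y2]; move: (expR (y i)) (expR_gt0 (y i)) y1 y2 => q q0 y1 y2.
rewrite -(ler_pM2r q0) mulrBl mulrDl mulVf ?gt_eqF //.
have : 0 <= (q - 1) ^+ 2 * (4 * q - 1) by rewrite mulr_ge0 ?sqr_ge0 //; lra.
lra.
Qed.

End PDGeometry.

(** * Borel measurability *)

Section Measurability.
Variables (R : realType) (m : nat).
Local Notation T := (PDm R m).
Implicit Types (X Y A B : T).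

Lemma measurable_dist_ball A (r : R) : measurable [set B : T | dist A B < r].
Proof. by rewrite dist.unlock; apply: sub_sigma_algebra; exists A, r. Qed.

(* Separability: a d-open set is the union of the balls it contains having
   a center exp(hm C) with C rational and a rational radius. *)
Lemma measurable_dist_open (S : set T) :
  (forall A, S A -> exists2 r : R, 0 < r & forall B, dist A B < r -> S B) -> measurable S.
Proof.
move=> So; pose ctr (C : 'M[rat]_m) : T := pe (map_mx (ratr : rat -> R) C).
pose bl (p : 'M[rat]_m * rat) : set T := [set B | dist (ctr p.1) B < ratr p.2].
pose F p := if `[< bl p `<=` S >] then bl p else set0.
rewrite (_ : S = \bigcup_p F p).
  apply: countable_bigcupT_measurable => // p.
  by rewrite /F; case: asboolP => _; [exact: measurable_dist_ball|exact: measurable0].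
apply/seteqP; split=> [A SA|A [p _]]; last by rewrite /F; case: asboolP => // h /h.
have [r r0 hr] := So _ SA.
have [M eM _] := pe_surj A.
have r3 : 0 < r / 3 by rewrite divr_gt0.
have [s s0 hs] := pe_continuous M r3.
have approx i j : exists q : rat, `|M i j - ratr q| <= s.
  have /rat_in_itvoo[q] : M i j - s < M i j + s by rewrite ltrD2l gtrN.
  rewrite in_itv /= => /andP[q1 q2]; exists q.
  by rewrite ler_norml; apply/andP; split; lra.
pose C : 'M[rat]_m := \matrix_(i, j) projT1 (cid (approx i j)).
have dC : dist (ctr C) A < r / 3.
  rewrite dist_sym -eM; apply: hs => i j; rewrite !mxE.
  by case: cid.
have /rat_in_itvoo[q] : r / 3 < r / 3 + r / 3 by rewrite ltrDl.
rewrite in_itv /= => /andP[q1 q2].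
exists (C, q) => //; rewrite /F; case: asboolP => [_|[]]; first exact: lt_trans q1.
move=> B hB; apply: hr; apply: le_lt_trans (dist_triangle (ctr C) A B) _.
by move: hB dC; rewrite /bl /= (dist_sym A); lra.
Qed.

Lemma measurable_dist_map (f : T -> T) :
  (forall A (e : R), 0 < e -> exists2 r : R, 0 < r & forall B, dist A B < r -> dist (f A) (f B) < e) ->
  measurable_fun [set: T] f.
Proof.
move=> cf; apply: (@measurability _ _ T T setT f (@rballs R m) erefl).
move=> _ [_ [C [r ->]] <-]; rewrite setTI.
rewrite (_ : f @^-1` _ = [set A | dist C (f A) < r]); last by rewrite dist.unlock.
apply: measurable_dist_open => A /= fA.
have e0 : 0 < r - dist C (f A) by rewrite subr_gt0.
have [s s0 hs] := cf A _ e0; exists s => // B /hs h.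
by apply: le_lt_trans (dist_triangle (f A) C (f B)) _; lra.
Qed.

Lemma measurable_dist_lipschitz (f : T -> R) (c : R) :
  (forall A B, f A - f B <= c * dist A B) -> measurable_fun [set: T] f.
Proof.
move=> cf; apply: (measurability _ (RGenOInfty.measurableE R)) => //.
move=> _ [_ [a ->] <-]; rewrite setTI preimage_itvoy; apply: measurable_dist_open => A /= aA.
have c0 : 0 < `|c| + 1 by rewrite ltr_pwDr.
exists ((f A - a) / (`|c| + 1)) => [|B]; first by rewrite divr_gt0 // subr_gt0.
rewrite ltr_pdivlMr // => h; have := cf A B; have := ler_norm c; have := dist_ge0 A B.
move: h; move: (dist A B) => d h d0 hc hf; nra.
Qed.

Lemma measurable_distl X : measurable_fun [set: T] (fun A => dist X A).
Proof.
apply: (@measurable_dist_lipschitz _ 1) => A B.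
by rewrite mul1r lerBlDr addrC (dist_sym A); exact: dist_triangle.
Qed.

Lemma measurable_ip_Lg (V : 'M[R[i]]_m) X : measurable_fun [set: T] (fun A => ip V (Lg X A)).
Proof.
apply: (@measurable_dist_lipschitz _ (nm V)) => A B.
rewrite -ipNr -ipDr; apply: le_trans (ler_norm _) _.
apply: le_trans (cauchy_schwarz _ _) _; rewrite ler_wpM2l ?nm_ge0 //; exact: emi.
Qed.

(** Rescaling logarithms is locally Lipschitz: [dist_le] bounds the distance of the images by |t|
    times the difference of logarithms, up to an exponential factor bounded on unit balls, and [emi]
    bounds that difference. *)
Lemma measurable_Lg_scale (f : T -> T) X Y (t : R) :
  (forall A, Lg Y (f A) = t%:C *: Lg X A) -> measurable_fun [set: T] f.
Proof.
move=> fE; apply: measurable_dist_map => A e e0.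
pose a := dist X A; have a0 : 0 <= a by exact: dist_ge0.
pose N := expR (`|t| * (2 * a + 1) / 2) * `|t|; have N0 : 0 <= N by rewrite mulr_ge0 ?expR_ge0.
have N1 : 0 < N + 1 by rewrite ltr_wpDl.
exists (Num.min 1 (e / (N + 1))); first by rewrite lt_min ltr01 divr_gt0.
move=> B; rewrite lt_min => /andP[d1]; rewrite ltr_pdivlMr // => d2.
have hd Z : dist Y (f Z) = `|t| * dist X Z by rewrite !dist_Lg fE nmZ.
apply: le_lt_trans (dist_le Y _ _) _; rewrite !hd !fE -scalerBr nmZ.
have hB : dist X B <= a + 1.
  by apply: le_trans (dist_triangle A _ _) _; rewrite lerD2l ltW.
apply: (@le_lt_trans _ _ (N * dist A B)).
  rewrite mulrA ler_pM ?mulr_ge0 ?expR_ge0 ?nm_ge0 //; last exact: emi.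
  rewrite ler_wpM2r // ler_expR ler_wpM2r // -mulrDr ler_wpM2l //; rewrite -/a; lra.
by move: (dist_ge0 A B) d2; rewrite mulrDr mulr1 mulrC; lra.
Qed.

Lemma measurable_geoPD X (t : R) : measurable_fun [set: T] (geoPD X t).
Proof. exact: (measurable_Lg_scale (Lg_geoPD X t)). Qed.

Lemma measurable_powPD (t : R) : measurable_fun [set: T] (@powPD R m t).
Proof. exact: (measurable_Lg_scale (Lg_powPD t)). Qed.

Lemma measurable_congrPD X : measurable_fun [set: T] (congrPD X).
Proof.
apply: (@measurable_Lg_scale _ X (PDone R m) 1) => A.
by rewrite Lg_congrPD scale1r.
Qed.

End Measurability.

(** * Cartan barycenter *)

Section Barycenter.
Variables (R : realType) (m : nat).
Local Notation T := (PDm R m).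
Variable nu : {measure set T -> \bar R}.
(** Total mass 1 is a separate hypothesis because [push] returns a bare measure. *)
Hypothesis nu1 : nu [set: T] = 1%E.
Hypothesis nuP1 : P1 nu.
Implicit Types (X Y Z A : T) (f g : T -> R).

Local Notation itg f := (nu.-integrable [set: T] (EFin \o f)).
Local Notation Ex f := (Rintegral nu [set: T] f).

Lemma itg_cst (c : R) : itg (fun=> c).
Proof.
apply/integrableP; split; first exact: measurable_cst.
rewrite (_ : (fun _ => _) = cst `|c|%:E); last by apply/funext.
by rewrite integral_cst // nu1 mule1 ltry.
Qed.

Lemma Ex_cst (c : R) : Ex (fun=> c) = c.
Proof. by rewrite /Rintegral integral_cst // nu1 mule1. Qed.

Lemma itgD f g : itg f -> itg g -> itg (fun A => f A + g A).
Proof. by move=> itf ig; exact: (integrableD _ itf ig). Qed.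

Lemma itgB f g : itg f -> itg g -> itg (fun A => f A - g A).
Proof. by move=> itf ig; exact: (integrableB _ itf ig). Qed.

Lemma itgZ (c : R) f : itg f -> itg (fun A => c * f A).
Proof. by move=> itf; exact: (integrableZl _ c itf). Qed.

Lemma itg_le f g : measurable_fun [set: T] f -> (forall A, `|f A| <= g A) -> itg g -> itg f.
Proof.
move=> mf fg; apply: le_integrable => //; first exact/measurable_EFinP.
by move=> A _ /=; rewrite lee_fin (le_trans (fg A)) // ler_norm.
Qed.

Lemma itg_dist X : itg (dist X).
Proof.
have [W itW] := nuP1; have {}itW : itg (dist W) by rewrite dist.unlock.
apply: itg_le (itgD (itg_cst (dist X W)) itW); first exact: measurable_distl.
by move=> A; rewrite ger0_norm ?dist_ge0 //; exact: dist_triangle.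
Qed.

Lemma itg_linear_growth X f (a b : R) : measurable_fun [set: T] f ->
  (forall A, `|f A| <= a + b * dist X A) -> itg f.
Proof. by move=> mf fb; apply: itg_le mf fb (itgD (itg_cst a) (itgZ b (itg_dist X))). Qed.

Lemma le_Ex f g : itg f -> itg g -> (forall A, f A <= g A) -> Ex f <= Ex g.
Proof. by move=> itf ig fg; apply: le_Rintegral => // A _; exact: fg. Qed.

Lemma ExD f g : itg f -> itg g -> Ex (fun A => f A + g A) = Ex f + Ex g.
Proof. by move=> itf ig; rewrite RintegralD. Qed.

Lemma ExB f g : itg f -> itg g -> Ex (fun A => f A - g A) = Ex f - Ex g.
Proof. by move=> itf ig; rewrite RintegralB. Qed.

Lemma ExZ (c : R) f : itg f -> Ex (fun A => c * f A) = c * Ex f.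
Proof. by move=> itf; rewrite RintegralZl. Qed.

Lemma Ex_ge0 f : (forall A, 0 <= f A) -> 0 <= Ex f.
Proof. by move=> f0; apply: Rintegral_ge0 => A _. Qed.

(* One-sided dominated convergence, applied to max(phi_n, psi). *)
Lemma Ex_limsup_ge0 (phi : nat -> T -> R) (psi C : T -> R) (e : nat -> R) X (a b : R) :
  (forall n, measurable_fun [set: T] (phi n)) -> measurable_fun [set: T] psi ->
  (forall n A, `|phi n A| <= a + b * dist X A) -> (forall A, `|psi A| <= a + b * dist X A) ->
  (forall n A, phi n A <= psi A + C A / n.+1%:R) ->
  (forall n, - e n <= Ex (phi n)) -> e n @[n --> \oo] --> (0 : R) ->
  0 <= Ex psi.
Proof.
move=> mphi mpsi bphi bpsi limsup_phi ephi e0.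
(* Only an upper bound of [phi] by [psi] is available; the maximum supplies the lower one, so [chi]
   converges to [psi] pointwise. *)
pose chi n A := Num.max (phi n A) (psi A).
have mchi n : measurable_fun [set: T] (chi n) by exact: measurable_maxr.
have bchi n A : `|chi n A| <= a + b * dist X A.
  by rewrite /chi; case: (leP (phi n A) (psi A)) => _; [exact: bpsi|exact: bphi].
have cchi A : chi n A @[n --> \oo] --> psi A.
  apply: (@squeeze_cvgr _ _ _ _ (fun=> psi A) (fun n => psi A + `|C A| * harmonic n)).
  - apply: nearW => n; rewrite /chi le_max lexx orbT /= ge_max lerDl.
    rewrite mulr_ge0 ?harmonic_ge0 // andbT (le_trans (limsup_phi n A)) // lerD2l.
    by rewrite ler_wpM2r ?invr_ge0 // ler_norm.
  - exact: cvg_cst.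
  - rewrite -[X in _ --> X]addr0 -[X in psi A + X](mulr0 `|C A|).
    apply: cvgD; first exact: cvg_cst.
    by apply: cvgM; [exact: cvg_cst|exact: cvg_harmonic].
have itdom := itgD (itg_cst a) (itgZ b (itg_dist X)).
have [itpsi _ lim_chi] : [/\ nu.-integrable [set: T] (EFin \o psi),
    ([sequence \int[nu]_(A in [set: T]) `|(chi n A)%:E - (psi A)%:E|]_n @ \oo --> 0)%E &
    ([sequence \int[nu]_(A in [set: T]) (chi n A)%:E]_n @ \oo --> \int[nu]_(A in [set: T]) (psi A)%:E)%E].
  apply: (@dominated_convergence _ _ _ nu [set: T] measurableT (fun n A => (chi n A)%:E)
    (fun A => (psi A)%:E) (fun A => (a + b * dist X A)%:E)) => //.
  - by move=> n; exact/measurable_EFinP.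
  - exact/measurable_EFinP.
  - by apply/aeW => A _; apply: cvg_EFin; [exact: nearW|exact: cchi].
  - by apply/aeW => A n _; rewrite lee_fin.
have fpsi : (\int[nu]_(A in [set: T]) (psi A)%:E)%E = (Ex psi)%:E.
  by rewrite /Rintegral fineK // integrable_fin_num.
have {}lim_chi : Ex (chi n) @[n --> \oo] --> Ex psi.
  by move: lim_chi; rewrite fpsi => /fine_cvgP[_].
have lim_e : - e n @[n --> \oo] --> (0 : R) by rewrite -oppr0; exact: cvgN.
apply: (ler_cvg_to lim_e lim_chi); apply: nearW => n; apply: le_trans (ephi n) _.
apply: le_Ex => [||A]; last by rewrite /chi le_max lexx.
- exact: itg_linear_growth (mphi n) (bphi n).
- exact: itg_linear_growth (mchi n) (bchi n).
Qed.

(** With only a first moment, the squared distance may fail to be integrable; this difference grows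
    linearly in [dist X A]. *)
Definition obj X Z A := dist Z A ^+ 2 - dist X A ^+ 2.

Lemma obj_le X Z A : `|obj X Z A| <= dist X Z ^+ 2 + 2 * dist X Z * dist X A.
Proof.
have h1 := dist_triangle X Z A; have h2 := dist_triangle Z X A.
rewrite (dist_sym Z X) in h1; rewrite /obj ler_norml.
have := dist_ge0 X Z; have := dist_ge0 X A; have := dist_ge0 Z A; move: h1 h2.
by move: (dist X Z) (dist X A) (dist Z A) => d x z h1 h2 *; apply/andP; split; nra.
Qed.

Lemma measurable_obj X Z : measurable_fun [set: T] (obj X Z).
Proof.
by apply: measurable_funB; apply: measurable_funX; exact: measurable_distl.
Qed.

Lemma itg_obj X Z : itg (obj X Z).
Proof. exact: itg_linear_growth (measurable_obj X Z) (obj_le X Z). Qed.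

Lemma Ex_obj_sub W X Z : Ex (obj X Z) = Ex (obj W Z) - Ex (obj W X).
Proof.
rewrite -ExB; [|exact: itg_obj..].
by congr Rintegral; apply/funext => A; rewrite /obj; ring.
Qed.

Lemma cartan_objE Z : cartan_obj nu Z = (Ex (obj (PDone R m) Z))%:E.
Proof.
rewrite /Rintegral fineK; last by apply: integrable_fin_num => //; exact: itg_obj.
by rewrite /cartan_obj; apply: eq_integral => A _; rewrite /obj dist.unlock.
Qed.

Definition minimizer X := forall Y, 0 <= Ex (obj X Y).

Lemma minimizerP X : minimizer X <-> forall Y, (cartan_obj nu X <= cartan_obj nu Y)%E.
Proof.
have E Y : (0 <= Ex (obj X Y)) = (cartan_obj nu X <= cartan_obj nu Y)%E.
  by rewrite !cartan_objE lee_fin (Ex_obj_sub (PDone R m) X Y) subr_ge0.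
by split=> minX Y; move: (minX Y); rewrite E.
Qed.

Lemma itg_ip_Lg (V : 'M[R[i]]_m) X : itg (fun A => ip V (Lg X A)).
Proof.
apply: (@itg_linear_growth X _ 0 (nm V)) => [|A]; first exact: measurable_ip_Lg.
by rewrite add0r dist_Lg; exact: cauchy_schwarz.
Qed.

(* CAT(0) law of cosines at X. *)
Lemma obj_ge X Y A : dist X Y ^+ 2 - 2 * ip (Lg X Y) (Lg X A) <= obj X Y A.
Proof.
have := emi X Y A; rewrite -ler_sqr ?nnegrE ?nm_ge0 ?dist_ge0 // sqr_nm ip_subsq.
by rewrite /obj !(dist_Lg X) !sqr_nm; lra.
Qed.

Definition balanced X := forall V : 'M[R[i]]_m, adjmx V = V -> Ex (fun A => ip V (Lg X A)) = 0.

(** Variance inequality: integrate [obj_ge]; balance at V = [Lg X Y] removes the linear term. *)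
Lemma balanced_variance X Y : balanced X -> dist X Y ^+ 2 <= Ex (obj X Y).
Proof.
move=> bX; have itI := itgZ 2 (itg_ip_Lg (Lg X Y) X).
have := le_Ex (itgB (itg_cst (dist X Y ^+ 2)) itI) (itg_obj X Y) (obj_ge X Y).
rewrite (ExB (itg_cst _) itI) Ex_cst (ExZ _ (itg_ip_Lg _ _)) (bX _ (Lg_herm X Y)).
by rewrite mulr0 subr0.
Qed.

(** Integrates [obj X Z A] >= d(X,Z)^2 - 2 d(X,Z) d(X,A), a consequence of the triangle inequality
    alone. *)
Lemma Ex_obj_coercive X Z : dist X Z * (dist X Z - 2 * Ex (dist X)) <= Ex (obj X Z).
Proof.
have -> : dist X Z * (dist X Z - 2 * Ex (dist X)) =
    Ex (fun A => dist X Z ^+ 2 - 2 * dist X Z * dist X A).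
  by rewrite (ExB (itg_cst _) (itgZ _ (itg_dist X))) Ex_cst (ExZ _ (itg_dist X)); ring.
apply: le_Ex => [||A]; [exact: itgB (itg_cst _) (itgZ _ (itg_dist X))|exact: itg_obj|].
have h1 := dist_triangle Z X A; have h2 := dist_triangle A X Z.
rewrite (dist_sym A Z) in h2; rewrite /obj.
have := dist_ge0 X Z; have := dist_ge0 X A; have := dist_ge0 Z A; move: h1 h2.
by move: (dist X Z) (dist X A) (dist Z A) => d x z h1 h2 *; nra.
Qed.

Lemma Ex_obj_norm X Z : `|Ex (obj X Z)| <= dist X Z * (dist X Z + 2 * Ex (dist X)).
Proof.
have -> : dist X Z * (dist X Z + 2 * Ex (dist X)) =
    Ex (fun A => dist X Z ^+ 2 + 2 * dist X Z * dist X A).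
  by rewrite (ExD (itg_cst _) (itgZ _ (itg_dist X))) Ex_cst (ExZ _ (itg_dist X)); ring.
have itB := itgD (itg_cst (dist X Z ^+ 2)) (itgZ (2 * dist X Z) (itg_dist X)).
rewrite ler_norml; apply/andP; split.
  rewrite lerNl -mulN1r -ExZ; last exact: itg_obj.
  apply: le_Ex => [||A]; [exact: itgZ (itg_obj X Z)|exact: itB|].
  by rewrite mulN1r; have := obj_le X Z A; rewrite ler_norml => /andP[+ _]; rewrite lerNl.
apply: le_Ex => [||A]; [exact: itg_obj|exact: itB|].
exact: le_trans (ler_norm _) (obj_le X Z A).
Qed.

(** Direct method in the chart [pe]: the objective is continuous in the matrix coordinates by
    [Ex_obj_norm], hence attains its minimum on a cube, and coercivity excludes smaller values
    elsewhere. *)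
Lemma minimizer_exists : exists X, minimizer X.
Proof.
pose I : T := PDone R m; pose K := Ex (dist I).
have K0 : 0 <= K by apply: Ex_ge0 => A; exact: dist_ge0.
pose f (v : 'rV[R]_(m * m)) := Ex (obj I (pe (vec_mx v))).
have cf : continuous f.
  move=> v; apply/(@cvgrPdist_lt R R _ (nbhs v)) => e e0.
  pose L := Ex (dist (pe (vec_mx v) : T)); have L0 : 0 <= L by apply: Ex_ge0 => A; exact: dist_ge0.
  have L1 : 0 < 1 + 2 * L by lra.
  have s0 : 0 < Num.min 1 (e / (1 + 2 * L)) by rewrite lt_min ltr01 divr_gt0.
  have [r r0 hr] := pe_continuous (vec_mx v) s0.
  apply/nbhs_ballP; exists r => // w vw.
  have := hr (vec_mx w); set d := dist _ _ => hd.
  have {hd} : d < Num.min 1 (e / (1 + 2 * L)).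
    apply: hd => i j; rewrite !mxE.
    by have [_ /(_ 0 (mxvec_index i j))] := vw; rewrite /ball /= => /ltW.
  rewrite lt_min => /andP[d1]; rewrite ltr_pdivlMr // => d2.
  rewrite distrC /f -Ex_obj_sub.
  apply: le_lt_trans (Ex_obj_norm _ _) _; rewrite -/d -/L; apply: le_lt_trans d2.
  by rewrite ler_wpM2l ?dist_ge0 // lerD2r ltW.
(* By [pe_surj] the cube covers the ball of radius 2K about I; outside that ball the objective is at
   least 0, its value at I. *)
pose S := [set v : 'rV[R]_(m * m) | forall k, v ord0 k \in `[(- (2 * K)), (2 * K)]].
have S0 : S (mxvec 0).
  by move=> k; rewrite (_ : mxvec 0 = 0) ?linear0 // mxE in_itv /= oppr_le0 mulr_ge0.
have cS : compact S.
  apply: (@rV_compact _ _ (fun=> `[(- (2 * K)), (2 * K)]%classic)) => _.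
  exact: segment_compact.
have [c _ cmin] := @EVT_min_rV R _ f S (ex_intro _ _ S0) cS (continuous_subspaceT cf).
have f_ge Z : f c <= Ex (obj I Z).
  have near Y : dist I Y <= 2 * K -> f c <= Ex (obj I Y).
    have [B <- hB] := pe_surj Y => hd; rewrite -[B]mxvecK; apply: cmin.
    rewrite inE => k; case/mxvec_indexP: k => i j; rewrite mxvecE in_itv /= -ler_norml.
    exact: le_trans (hB i j) hd.
  have [/near//|hZ] := leP (dist I Z) (2 * K).
  apply: (@le_trans _ _ 0).
    have := near I; rewrite dist_refl mulr_ge0 // => /(_ isT).
    by rewrite (_ : Ex (obj I I) = 0) // (Ex_obj_sub I) subrr.
  apply: le_trans (Ex_obj_coercive I Z); rewrite -/K mulr_ge0 ?dist_ge0 //; lra.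
by exists (pe (vec_mx c)) => Y; rewrite (Ex_obj_sub I) subr_ge0; exact: f_ge.
Qed.

Lemma cartan_minimizer : minimizer (cartan nu).
Proof.
have [X /minimizerP minX] := minimizer_exists; apply/minimizerP.
exact: (@xgetPex _ (PDone R m)
  [set Z | forall Y : PD R m, (cartan_obj nu Z <= cartan_obj nu Y)%E] (ex_intro _ X minX)).
Qed.

(** The objective at [cartan nu], relative to X, is at most 0 by minimality and at least the squared
    distance by the variance inequality. *)
Lemma balanced_cartan X : balanced X -> X = cartan nu.
Proof.
move=> bX; apply: dist_eq0; apply/eqP; rewrite -sqrf_eq0 eq_le sqr_ge0 andbT.
apply: le_trans (balanced_variance _ bX) _.
have := cartan_minimizer X; rewrite (Ex_obj_sub X) (_ : Ex (obj X X) = 0).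
  by rewrite sub0r oppr_ge0.
by rewrite (Ex_obj_sub X) subrr.
Qed.

End Barycenter.

(** * First variation of the barycenter functional *)

Section FirstVariation.
Variables (R : realType) (m : nat).
Local Notation T := (PDm R m).
Implicit Types (X Y Z A : T).
Local Notation Ex nu f := (Rintegral nu [set: T] f).

Section Measure.
Variable nu : {measure set T -> \bar R}.
Hypothesis nu1 : nu [set: T] = 1%E.
Hypothesis nuP1 : P1 nu.

(** Squared form of [dist_le] for points at times s and t on two geodesics from X: the Euclidean
    distance in the tangent space is an upper bound up to a factor that tends to 1. *)
Lemma dist_tangent_le X Y A G H (s t : R) : 0 <= s -> 0 <= t ->
  Lg X G = s%:C *: Lg X Y -> Lg X H = t%:C *: Lg X A ->
  dist G H ^+ 2 <= expR (s * dist X Y + t * dist X A) *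
    ip (s%:C *: Lg X Y - t%:C *: Lg X A) (s%:C *: Lg X Y - t%:C *: Lg X A).
Proof.
move=> s0 t0 hG hH; have := dist_le X G H.
rewrite (dist_Lg X G) (dist_Lg X H) hG hH !nmZ (ger0_norm s0) (ger0_norm t0) -!dist_Lg.
rewrite -ler_sqr ?nnegrE ?dist_ge0 ?mulr_ge0 ?expR_ge0 ?nm_ge0 // => /le_trans; apply.
by rewrite exprMn sqr_nm [X in X * _ <= _]expr2 -expRD -splitr.
Qed.

Lemma geodesic_point X A (r : R) : r <= 1 -> exists P : T,
  Lg X P = r%:C *: Lg X A /\ dist P A = (1 - r) * dist X A.
Proof.
move=> r1; exists (geoPD X r A); split; first exact: Lg_geoPD.
by rewrite dist_geoPDr ger0_norm // subr_ge0.
Qed.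

Lemma ip_sub_bounds X Y A (l : R) : 1 <= l ->
  ip (Lg X Y - l%:C *: Lg X A) (Lg X Y - l%:C *: Lg X A) =
    dist X Y ^+ 2 - 2 * l * ip (Lg X Y) (Lg X A) + l ^+ 2 * dist X A ^+ 2 /\
  ip (Lg X Y - l%:C *: Lg X A) (Lg X Y - l%:C *: Lg X A) <=
    l ^+ 2 * (dist X Y + dist X A) ^+ 2.
Proof.
move=> l1; rewrite !dist_Lg; split.
  by rewrite ip_subsq !ipZr ipZl !sqr_nm; move: (ip _ _) (ip (Lg X A) _) (ip (Lg X Y) (Lg X A)) => *; ring.
rewrite -sqr_nm -exprMn ler_sqr ?nnegrE ?nm_ge0 ?mulr_ge0 ?addr_ge0 ?nm_ge0 ?(le_trans ler01) //.
apply: le_trans (nmD _ _) _; rewrite nmN nmZ ger0_norm ?(le_trans ler01) // mulrDr lerD2r.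
by rewrite ler_peMl ?nm_ge0.
Qed.

(* With step s = 1/N^3 towards Y and r = 1/N^2 towards A, the triangle inequality through
   the point at time r on the geodesic from X to A gives the first variation of d^2. *)
Lemma first_variation X Y A G n (N := n.+1%:R : R) (w := dist X Y + dist X A) :
  Lg X G = (N ^- 3)%:C *: Lg X Y ->
  N ^+ 3 * obj X G A <=
  - 2 * ip (Lg X Y) (Lg X A) + (dist X Y ^+ 2 + w ^+ 3 * expR w) / N.
Proof.
move=> hG; have N0 : 0 < N by rewrite ltr0n.
have N1 : 1 <= N by rewrite ler1n.
have s0 : 0 < N ^- 3 by rewrite invr_gt0 exprn_gt0.
have r0 : 0 < N ^- 2 by rewrite invr_gt0 exprn_gt0.
have r1 : N ^- 2 <= 1 by rewrite invf_le1 ?exprn_gt0 // exprn_ege1.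
have sr : N ^- 3 <= N ^- 2 by rewrite lef_pV2 ?posrE ?exprn_gt0 //; apply: ler_weXn2l.
have v0 := dist_ge0 X Y; have D0 := dist_ge0 X A.
have [P [hP dP]] := geodesic_point X A r1.
have tri := dist_triangle P G A; rewrite dP in tri.
have tgt := dist_tangent_le (ltW s0) (ltW r0) hG hP.
have [ipE ip_le] := ip_sub_bounds X Y A N1.
have scale : (N ^- 3)%:C *: Lg X Y - (N ^- 2)%:C *: Lg X A = (N ^- 3)%:C *: (Lg X Y - N%:C *: Lg X A).
  rewrite scalerBr scalerA -rmorphM; congr (_ - _%:C *: _).
  by field; rewrite gt_eqF.
rewrite scale ipZl ipZr in tgt.
have q0 := ip_ge0 (Lg X Y - N%:C *: Lg X A).
set a := dist G P in tri tgt.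
have a0 : 0 <= a by exact: dist_ge0.
have E_le : expR (N ^- 3 * dist X Y + N ^- 2 * dist X A) <= 1 + w / N ^+ 2 * expR w.
  have h1 : N ^- 3 * dist X Y + N ^- 2 * dist X A <= w / N ^+ 2.
    by rewrite /w mulrDl mulrC (mulrC (N ^- 2)) lerD2r ler_wpM2l.
  have h2 : w / N ^+ 2 <= w by rewrite ler_piMr // addr_ge0.
  rewrite (le_trans (_ : _ <= expR (w / N ^+ 2))) ?ler_expR //.
  rewrite (le_trans (expR_le_Mexp _)) // lerD2l ler_wpM2l ?ler_expR //.
  by rewrite mulr_ge0 ?addr_ge0 // ltW.
move: ipE ip_le tgt E_le q0; rewrite /obj.
set q := ip (Lg X Y - _) _; set p := ip (Lg X Y) _; set E := expR (_ + _).
set d := dist G A in tri *; have d0 : 0 <= d by exact: dist_ge0.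
have W0 := expR_ge0 w; have w0 : 0 <= w by exact: addr_ge0.
have wE : w = dist X Y + dist X A by [].
clearbody w; move: (dist X Y) (dist X A) a d q p E (expR w) wE tri W0 v0 D0 a0 d0.
move=> v D a d q p E W wE tri W0 v0 D0 a0 d0 qE q_le tgt E_le q0; rewrite -wE in q_le.
(* Convexity of the square with weights r = N^-2 and 1 - r, applied to a/r and D. *)
have d2 : d ^+ 2 <= N ^+ 2 * a ^+ 2 + (1 - N ^- 2) * D ^+ 2.
  apply: (@le_trans _ _ ((a + (1 - N ^- 2) * D) ^+ 2)).
    by rewrite ler_sqr ?nnegrE // addr_ge0 // mulr_ge0 ?subr_ge0.
  rewrite -subr_ge0.
  have -> : N ^+ 2 * a ^+ 2 + (1 - N ^- 2) * D ^+ 2 - (a + (1 - N ^- 2) * D) ^+ 2 =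
     (1 - N ^- 2) * (N * a - D / N) ^+ 2 by field; rewrite gt_eqF.
  by rewrite mulr_ge0 ?sqr_ge0 // subr_ge0.
have step1 : N ^+ 3 * (d ^+ 2 - D ^+ 2) <= E * q / N - N * D ^+ 2.
  have h : N ^+ 5 * a ^+ 2 <= E * q / N.
    have -> : E * q / N = N ^+ 5 * (E * (N ^- 3 * (N ^- 3 * q))) by field; rewrite gt_eqF.
    by rewrite ler_wpM2l // exprn_ge0 // ltW.
  apply: (@le_trans _ _ (N ^+ 5 * a ^+ 2 - N * D ^+ 2)); last by rewrite lerD2r.
  have -> : N ^+ 5 * a ^+ 2 - N * D ^+ 2 = N ^+ 3 * ((N ^+ 2 * a ^+ 2 + (1 - N ^- 2) * D ^+ 2) - D ^+ 2).
    by field; rewrite gt_eqF.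
  by rewrite ler_wpM2l ?exprn_ge0 ?(ltW N0) // lerD2r.
apply: le_trans step1 _.
(* Here q is O(N^2) and E - 1 is O(N^-2), so replacing E by 1 costs only O(1/N). *)
have step2 : E * q / N <= q / N + w ^+ 3 * W / N.
  apply: (@le_trans _ _ ((1 + w / N ^+ 2 * W) * q / N)).
    by rewrite ler_wpM2r ?invr_ge0 ?(ltW N0) // ler_wpM2r.
  rewrite -mulrDl ler_wpM2r ?invr_ge0 ?(ltW N0) // mulrDl mul1r lerD2l.
  have -> : w ^+ 3 * W = w / N ^+ 2 * W * (N ^+ 2 * w ^+ 2) by field; rewrite gt_eqF.
  by rewrite ler_wpM2l // !mulr_ge0 // ltW.
(* Expanding q, the two terms N D^2 cancel exactly and the cross term becomes -2p. *)
apply: (@le_trans _ _ (q / N + w ^+ 3 * W / N - N * D ^+ 2)); first by rewrite lerD2r.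
by rewrite qE le_eqVlt; apply/orP; left; apply/eqP; field; rewrite gt_eqF.
Qed.

Lemma minimizer_balanced X : minimizer nu X -> balanced nu X.
Proof.
move=> minX.
(* One inequality suffices, since V may be replaced by -V. *)
suff H (V : 'M[R[i]]_m) : adjmx V = V -> Ex nu (fun A => ip V (Lg X A)) <= 0.
  move=> V aV; apply/eqP; rewrite eq_le H //=.
  have /H : adjmx (- V) = - V by rewrite -[in RHS]aV; apply/matrixP => i j; rewrite !mxE rmorphN.
  rewrite (_ : (fun A => ip (- V) _) = (fun A => - 1 * ip V (Lg X A))); last first.
    by apply/funext => A; rewrite ipNl mulN1r.
  by rewrite (ExZ _ (itg_ip_Lg nu1 nuP1 _ _)) mulN1r oppr_le0.
move=> aV; have [Y eV] := Lg_surj X aV; rewrite -eV.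
pose N n : R := n.+1%:R; have N0 n : 0 < N n by rewrite ltr0n.
have N1 n : 1 <= N n by rewrite ler1n.
pose G n : T := geoPD X (N n ^- 3) Y.
have hG n : Lg X (G n) = (N n ^- 3)%:C *: Lg X Y := Lg_geoPD X _ Y.
clearbody G; have mip := measurable_ip_Lg (Lg X Y) X.
suff : 0 <= Ex nu (fun A => - 2 * ip (Lg X Y) (Lg X A)).
  by rewrite (ExZ _ (itg_ip_Lg nu1 nuP1 _ _)); lra.
(* The functions are difference quotients of the objective for steps N^-3 towards Y; minimality
   makes their means nonnegative, so the error sequence is 0. *)
apply: (@Ex_limsup_ge0 _ _ nu nu1 nuP1
  (fun n A => N n ^+ 3 * obj X (G n) A) _
  (fun A => dist X Y ^+ 2 + (dist X Y + dist X A) ^+ 3 * expR (dist X Y + dist X A))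
  (fun=> 0) X (dist X Y ^+ 2) (2 * dist X Y)).
- by move=> n; apply: measurable_funM; [exact: measurable_cst|exact: measurable_obj].
- by apply: measurable_funM; [exact: measurable_cst|exact: mip].
- move=> n A; have s0 : 0 < N n ^- 3 by rewrite invr_gt0 exprn_gt0.
  have s1 : N n ^- 3 <= 1 by rewrite invf_le1 ?exprn_gt0 // exprn_ege1.
  rewrite normrM gtr0_norm ?exprn_gt0 //.
  have := obj_le X (G n) A; rewrite (dist_Lg X (G n)) hG nmZ (gtr0_norm s0) -dist_Lg => h.
  rewrite mulrC -ler_pdivlMr ?exprn_gt0 // mulrC (le_trans h) //.
  rewrite mulrDr; apply: lerD; last by rewrite le_eqVlt; apply/orP; left; apply/eqP; ring.
  by rewrite exprMn expr2 -mulrA ler_wpM2l ?(ltW s0) // ler_piMl ?sqr_ge0.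
- move=> A; rewrite normrM normrN normr_nat.
  apply: (@le_trans _ _ (2 * (dist X Y * dist X A))).
    by rewrite ler_wpM2l // !dist_Lg; exact: cauchy_schwarz.
  by rewrite mulrA lerDr sqr_ge0.
- by move=> n A; exact: first_variation (hG n).
- by move=> n; rewrite oppr0 (ExZ _ (itg_obj nu1 nuP1 _ _)) mulr_ge0 ?exprn_ge0 ?(ltW (N0 _)).
- exact: cvg_cst.
Qed.

Lemma cartanP X : X = cartan nu <-> balanced nu X.
Proof.
split=> [->|]; last exact: balanced_cartan.
by apply: minimizer_balanced; exact: cartan_minimizer.
Qed.

End Measure.

(** * Moments and balance under push-forward *)

Section PushForward.
Variables (mu : {measure set T -> \bar R}) (f : T -> T).
Hypothesis mu1 : mu [set: T] = 1%E.
Hypothesis muP1 : P1 mu.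
Hypothesis mf : measurable_fun [set: T] f.

Lemma push_pushforward : (push mu f : set T -> \bar R) = pushforward mu f.
Proof. by rewrite /push; case: pselect => // mf'; apply/funext => S. Qed.

Lemma push_setT : push mu f [set: T] = 1%E.
Proof. by rewrite push_pushforward /pushforward preimage_setT. Qed.

Lemma Ex_push (g : T -> R) : measurable_fun [set: T] g ->
  mu.-integrable [set: T] (EFin \o (g \o f)) -> Ex (push mu f) g = Ex mu (g \o f).
Proof.
move=> mg ig; rewrite /Rintegral push_pushforward integral_pushforward //.
exact/measurable_EFinP.
Qed.

Lemma P1_push X Y (t : R) : (forall A, Lg Y (f A) = t%:C *: Lg X A) -> P1 (push mu f).
Proof.
move=> fE; exists Y; rewrite push_pushforward.
have md := measurable_distl Y; rewrite dist.unlock in md.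
apply: integrable_pushforward => //; first exact/measurable_EFinP.
have := itgZ `|t| (itg_dist mu1 muP1 X).
congr (mu.-integrable _ _); apply/funext => A /=; congr EFin.
have -> : rdist (val Y) (val (f A)) = dist Y (f A) by rewrite dist.unlock.
by rewrite !dist_Lg fE nmZ.
Qed.

Lemma balanced_push X Y (t : R) : (forall A, Lg Y (f A) = t%:C *: Lg X A) ->
  forall V, Ex (push mu f) (fun A => ip V (Lg Y A)) = t * Ex mu (fun A => ip V (Lg X A)).
Proof.
move=> fE V; have itip := itg_ip_Lg mu1 muP1 V X.
have E : (fun A => ip V (Lg Y A)) \o f = (fun A => t * ip V (Lg X A)).
  by apply/funext => A /=; rewrite fE ipZr.
rewrite Ex_push; [|exact: measurable_ip_Lg|]; rewrite E; last exact: itgZ.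
exact: ExZ.
Qed.

End PushForward.

End FirstVariation.

(** * The derivative of beta at 0 *)

Section DerivativeAtZero.
Variables (R : realType) (m : nat).
Local Notation T := (PDm R m).
Implicit Types (X Y Z A : T).
Local Notation Ex nu f := (Rintegral nu [set: T] f).

(** Both points sit at time 1/N on geodesics from X, so multiplying by N^2 recovers |V - L|^2 -
    |L|^2 for V = [Lg X Y] and L = [Lg X A], up to O(1/N). *)
Lemma obj_small_time X Y A G H n (N := n.+1%:R : R) (w := dist X Y + dist X A) :
  Lg X G = (N^-1)%:C *: Lg X Y -> Lg X H = (N^-1)%:C *: Lg X A ->
  N ^+ 2 * obj X G H <=
  dist X Y ^+ 2 - 2 * ip (Lg X Y) (Lg X A) + w ^+ 3 * expR w / N.
Proof.
move=> hG hH; have N0 : 0 < N by rewrite ltr0n.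
have N1 : 1 <= N by rewrite ler1n.
have Ni0 : 0 <= N^-1 by rewrite invr_ge0 ltW.
have v0 := dist_ge0 X Y; have D0 := dist_ge0 X A.
have tgt := dist_tangent_le Ni0 Ni0 hG hH.
have [] := ip_sub_bounds X Y A (lexx 1); rewrite (scale1r (Lg X A)) => ipE ip_le.
rewrite -scalerBr ipZl ipZr -mulrDr in tgt.
have q0 := ip_ge0 (Lg X Y - Lg X A).
have E_le : expR (N^-1 * w) <= 1 + N^-1 * w * expR w.
  apply: le_trans (expR_le_Mexp _) _; rewrite lerD2l ler_wpM2l ?mulr_ge0 ?addr_ge0 //.
  by rewrite ler_expR ler_piMl ?addr_ge0 // invf_le1.
rewrite /obj (dist_Lg X H) hH nmZ (ger0_norm Ni0) -dist_Lg.
have W0 := expR_ge0 w; have w0 : 0 <= w by exact: addr_ge0.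
rewrite -/w in tgt ip_le; move: ipE ip_le tgt E_le q0.
set q := ip (Lg X Y - _) _; set p := ip (Lg X Y) _; set E := expR (_ * w).
clearbody w; move: (dist X Y) (dist X A) (dist G H) q p E (expR w) W0 v0 D0.
move=> v D d q p E W W0 v0 D0 qE q_le tgt E_le q0.
apply: (@le_trans _ _ (E * q - D ^+ 2)).
  have -> : E * q - D ^+ 2 = N ^+ 2 * (E * (N^-1 * (N^-1 * q)) - (N^-1 * D) ^+ 2).
    by field; rewrite gt_eqF.
  by rewrite ler_wpM2l ?exprn_ge0 ?(ltW N0) // lerD2r.
apply: (@le_trans _ _ ((1 + N^-1 * w * W) * q - D ^+ 2)); first by rewrite lerD2r ler_wpM2r.
have h : N^-1 * w * W * q <= N^-1 * w * W * w ^+ 2.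
  by rewrite ler_wpM2l ?mulr_ge0 //; move: q_le; rewrite expr1n mul1r.
have -> : w ^+ 3 * W / N = N^-1 * w * W * w ^+ 2 by ring.
have {}qE : q = v ^+ 2 - 2 * p + D ^+ 2 by rewrite qE; ring.
by rewrite mulrDl mul1r; move: (N^-1 * w * W * q) (N^-1 * w * W * w ^+ 2) h => x y h; rewrite qE; lra.
Qed.

(* If the barycenters b n at time 1/(n+1) stay at distance o(1/n) from X, the
   objective at time 1/(n+1) is at least o(1/n^2), whereas moving from X with
   velocity V changes it by (|V|^2 - 2 int <V, Lg X A>)/n^2 + o(1/n^2). *)
Lemma balanced_of_small_time (mu : {measure set T -> \bar R}) X (f : nat -> T -> T) (b : nat -> T) :
  mu [set: T] = 1%E -> P1 mu ->
  (forall n, measurable_fun [set: T] (f n)) ->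
  (forall n A, Lg X (f n A) = (n.+1%:R^-1 : R)%:C *: Lg X A) ->
  (forall n, minimizer (push mu (f n)) (b n)) ->
  n.+1%:R * dist X (b n) @[n --> \oo] --> (0 : R) ->
  balanced mu X.
Proof.
move=> mu1 muP1 mf hf minb b0.
pose N n : R := n.+1%:R; have N0 n : 0 < N n by rewrite ltr0n.
have N1 n : 1 <= N n by rewrite ler1n.
pose K := Ex mu (dist X); have K0 : 0 <= K by apply: Ex_ge0 => A; exact: dist_ge0.
have itip V := itg_ip_Lg mu1 muP1 V X.
have dXf n A : dist X (f n A) = (N n)^-1 * dist X A.
  by rewrite dist_Lg hf nmZ -dist_Lg ger0_norm // invr_ge0 ltW.
have key Y : 2 * Ex mu (fun A => ip (Lg X Y) (Lg X A)) <= dist X Y ^+ 2.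
  suff : 0 <= Ex mu (fun A => dist X Y ^+ 2 - 2 * ip (Lg X Y) (Lg X A)).
    rewrite (ExB (itg_cst mu1 _) (itgZ 2 (itip _))) (Ex_cst mu1) (ExZ _ (itip _)).
    by rewrite subr_ge0.
  pose G n : T := geoPD X (N n)^-1 Y.
  have hG n : Lg X (G n) = ((N n)^-1)%:C *: Lg X Y := Lg_geoPD X _ Y.
  clearbody G; have dXG n : dist X (G n) = (N n)^-1 * dist X Y.
    by rewrite (dist_Lg X (G n)) hG nmZ -dist_Lg ger0_norm // invr_ge0 ltW.
  have bphi n A : `|N n ^+ 2 * obj X (G n) (f n A)| <= dist X Y ^+ 2 + 2 * dist X Y * dist X A.
    rewrite normrM (@ger0_norm _ (N n ^+ 2)) ?exprn_ge0 ?(ltW (N0 n)) //.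
    apply: (@le_trans _ _ (N n ^+ 2 * (dist X (G n) ^+ 2 + 2 * dist X (G n) * dist X (f n A)))).
      by rewrite ler_wpM2l ?exprn_ge0 ?(ltW (N0 n)) //; exact: obj_le.
    rewrite dXG dXf le_eqVlt; apply/orP; left; apply/eqP.
    by move: (dist X Y) (dist X A) => v D; field; rewrite gt_eqF.
  have mphi n : measurable_fun [set: T] (fun A => N n ^+ 2 * obj X (G n) (f n A)).
    apply: measurable_funM; first exact: measurable_cst.
    by apply: measurableT_comp; [exact: measurable_obj|exact: mf].
  apply: (@Ex_limsup_ge0 _ _ mu mu1 muP1 (fun n A => N n ^+ 2 * obj X (G n) (f n A)) _
    (fun A => (dist X Y + dist X A) ^+ 3 * expR (dist X Y + dist X A))
    (fun n => 2 * K * (N n * dist X (b n))) X (dist X Y ^+ 2) (2 * dist X Y) mphi _ bphi).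
  - apply: measurable_funB; first exact: measurable_cst.
    by apply: measurable_funM; [exact: measurable_cst|exact: measurable_ip_Lg].
  - move=> A; apply: le_trans (ler_normB _ _) _.
    rewrite ger0_norm ?sqr_ge0 // lerD2l normrM normr_nat -mulrA ler_wpM2l //.
    by rewrite !dist_Lg; exact: cauchy_schwarz.
  - by move=> n A; exact: obj_small_time (hG n) (hf n A).
  - move=> n; have p1 := push_setT mu1 (mf n).
    have pP1 := P1_push mu1 muP1 (mf n) (hf n).
    have itf (g : T -> R) : measurable_fun [set: T] g ->
        (forall A, `|g A| <= dist X (G n) ^+ 2 + 2 * dist X (G n) * dist X A) ->
        mu.-integrable [set: T] (EFin \o (g \o f n)).
      move=> mg bg; apply: (itg_linear_growth mu1 muP1 (X := X) (a := dist X (G n) ^+ 2)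
         (b := 2 * dist X (G n) * (N n)^-1)).
        by apply: measurableT_comp; [exact: mg|exact: mf].
      by move=> A; apply: le_trans (bg _) _; rewrite dXf mulrA.
    have EG : Ex mu (fun A => N n ^+ 2 * obj X (G n) (f n A)) =
        N n ^+ 2 * Ex (push mu (f n)) (obj X (G n)).
      have it := itf _ (measurable_obj X (G n)) (obj_le X (G n)).
      by rewrite (Ex_push (mf n) (measurable_obj X (G n)) it) -(ExZ _ it).
    have EK : Ex (push mu (f n)) (dist X) = (N n)^-1 * K.
      have E : dist X \o f n = (fun A => (N n)^-1 * dist X A) by apply/funext => A /=.
      have it := itg_dist mu1 muP1 X.
      rewrite (Ex_push (mf n) (measurable_distl X)) E; last exact: itgZ.
      exact: ExZ.
    (* Minimality compares [G n] with [b n]. The mean distance to X is now K/N, so with d =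
       [dist X (b n)] coercivity, scaled by N^2, gives the lower bound (N d)^2 - 2K (N d), whence
       the chosen error sequence. *)
    have h1 := minb n (G n); rewrite (Ex_obj_sub p1 pP1 X) subr_ge0 in h1.
    have h2 := Ex_obj_coercive p1 pP1 X (b n); rewrite EK in h2.
    rewrite EG; move: (dist X (b n)) (dist_ge0 X (b n)) h1 h2 => d d0 h1 h2.
    apply: le_trans (_ : _ <= N n ^+ 2 * (d * (d - 2 * ((N n)^-1 * K)))) _; last first.
      by rewrite ler_wpM2l ?exprn_ge0 ?(ltW (N0 n)) // (le_trans h2).
    have -> : N n ^+ 2 * (d * (d - 2 * ((N n)^-1 * K))) = (N n * d) ^+ 2 - 2 * K * (N n * d).
      by field; rewrite gt_eqF.
    by rewrite lerDr sqr_ge0.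
  - rewrite -[X in _ --> X](mulr0 (2 * K)).
    by apply: cvgM; [exact: cvg_cst|exact: b0].
have key2 (V : 'M[R[i]]_m) : adjmx V = V -> Ex mu (fun A => ip V (Lg X A)) <= 0.
  (* Apply [key] at V/N: the linear term scales by 1/N and the quadratic one by 1/N^2, so the mean
     is at most |V|^2 / (2N). *)
  move=> aV; apply: (@le_of_le_harmonic _ _ _ (nm V ^+ 2 / 2)) => n; rewrite add0r.
  have aV' : adjmx (((N n)^-1)%:C *: V) = ((N n)^-1)%:C *: V.
    rewrite -[in RHS]aV; apply/matrixP => i j; rewrite !mxE rmorphM; congr (_ * _).
    exact: conjc_real.
  have [Y eY] := Lg_surj X aV'; have := key Y.
  rewrite dist_Lg eY nmZ ger0_norm ?invr_ge0 ?(ltW (N0 n)) //.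
  rewrite (_ : (fun A => ip (_ *: _) _) = (fun A => (N n)^-1 * ip V (Lg X A))); last first.
    by apply/funext => A; rewrite ipZl.
  rewrite (ExZ _ (itip _)); move: (Ex mu _) (nm V) => e v h.
  have : N n * (2 * ((N n)^-1 * e)) <= N n * ((N n)^-1 * v) ^+ 2 by rewrite ler_wpM2l // ltW.
  have -> : N n * (2 * ((N n)^-1 * e)) = 2 * e by field; rewrite gt_eqF.
  have -> : N n * ((N n)^-1 * v) ^+ 2 = 2 * (v ^+ 2 / 2 / N n) by field; rewrite gt_eqF.
  by rewrite ler_pM2l.
move=> V aV; apply/eqP; rewrite eq_le key2 //=.
have /key2 : adjmx (- V) = - V by rewrite -[in RHS]aV; apply/matrixP => i j; rewrite !mxE rmorphN.
rewrite (_ : (fun A => ip (- V) _) = (fun A => - 1 * ip V (Lg X A))); last first.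
  by apply/funext => A; rewrite ipNl mulN1r.
by rewrite (ExZ _ (itip _)) mulN1r oppr_le0.
Qed.

Lemma is_derive_cvg_seq (g : R -> R) : is_derive (0 : R) (1 : R) g 0 ->
  n.+1%:R * (g n.+1%:R^-1 - g 0) @[n --> \oo] --> (0 : R).
Proof.
move=> [dg vg].
have := dg; rewrite /derivable => /cvg_ex[l hl].
have l0 : l = 0 by rewrite -vg /derive; apply/esym/cvg_lim.
rewrite l0 in hl; have /cvgr_dnbhsP h := hl.
have {h} : _ := h (fun n => n.+1%:R^-1) (conj (fun n => invr_neq0 (lt0r_neq0 (ltr0Sn R n))) cvg_harmonic).
apply: cvg_trans; apply: near_eq_cvg; apply: nearW => n /=.
by rewrite invrK /GRing.scale /= mulr1 addr0.
Qed.

Lemma cvg_sum0 (I : Type) (r : seq I) (F : I -> nat -> R) :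
  (forall i, F i n @[n --> \oo] --> (0 : R)) -> \sum_(i <- r) F i n @[n --> \oo] --> (0 : R).
Proof.
move=> F0; elim: r => [|i r IH].
  by rewrite (_ : (fun n => _) = (fun=> 0)); [exact: cvg_cst|apply/funext => n; rewrite big_nil].
rewrite (_ : (fun n => _) = (fun n => F i n + \sum_(j <- r) F j n)).
  by rewrite -[X in _ --> X]addr0; apply: cvgD.
by apply/funext => n; rewrite big_cons.
Qed.

Lemma cvg_dist_of_entries X (b : nat -> T) :
  (forall i j, n.+1%:R * (complex.Re (val (b n : PD R m) i j) -
    complex.Re (val (X : PD R m) i j)) @[n --> \oo] --> (0 : R)) ->
  (forall i j, n.+1%:R * (complex.Im (val (b n : PD R m) i j) -
    complex.Im (val (X : PD R m) i j)) @[n --> \oo] --> (0 : R)) ->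
  n.+1%:R * dist X (b n) @[n --> \oo] --> (0 : R).
Proof.
move=> hRe hIm; pose N n : R := n.+1%:R; have N0 n : 0 < N n by rewrite ltr0n.
have N1 n : 1 <= N n by rewrite ler1n.
pose Z n := val (b n : PD R m) - val (X : PD R m).
have ip0 : N n ^+ 2 * ip (Z n) (Z n) @[n --> \oo] --> (0 : R).
  rewrite (_ : (fun n => _) = (fun n => \sum_i \sum_j
     ((N n * (complex.Re (val (b n : PD R m) i j) - complex.Re (val (X : PD R m) i j))) ^+ 2 +
      (N n * (complex.Im (val (b n : PD R m) i j) - complex.Im (val (X : PD R m) i j))) ^+ 2))); last first.
    apply/funext => n; rewrite ipE mulr_sumr; apply: eq_bigr => i _.
    rewrite mulr_sumr; apply: eq_bigr => j _; rewrite /Z !mxE.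
    by case: (val (b n) i j) => x y; case: (val X i j) => z t /=; ring.
  apply: cvg_sum0 => i; apply: cvg_sum0 => j.
  rewrite -[X in _ --> X]addr0 -[X in _ --> X + _](mulr0 0) -[X in _ --> _ + X](mulr0 0).
  by apply: cvgD; [apply: cvgM; exact: hRe|apply: cvgM; exact: hIm].
have nm0 : N n * nm (Z n) @[n --> \oo] --> (0 : R).
  rewrite -[X in _ --> X]sqrtr0.
  rewrite (_ : (fun n => _) = (fun n => Num.sqrt (N n ^+ 2 * ip (Z n) (Z n)))); last first.
    by apply/funext => n; rewrite -sqr_nm -exprMn sqrtr_sqr ger0_norm // mulr_ge0 ?nm_ge0 // ltW.
  exact: (continuous_cvg _ (@sqrt_continuous R 0) ip0).
have [c c0 hc] := dist_le_nm X.
apply: (@squeeze_cvgr _ _ _ _ (fun=> 0) (fun n => 2 * c * (N n * nm (Z n)))).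
(* As N >= 1, this threshold on N |Z_n| also puts [b n] in the neighborhood of X where [dist_le_nm]
   holds. *)
- have e0 : 0 < 1 / 2 / c by rewrite !divr_gt0.
  move/cvgrPdist_lt/(_ _ e0): nm0; apply: filterS => n.
  rewrite sub0r normrN (ger0_norm (mulr_ge0 (ltW (N0 n)) (nm_ge0 (Z n)))) => h.
  rewrite (mulr_ge0 (ltW (N0 n)) (dist_ge0 X (b n))) /=.
  rewrite [leRHS]mulrCA; apply: (ler_wpM2l (ltW (N0 n))); rewrite -mulrA.
  apply: hc; rewrite mulrC -ler_pdivlMr // ltW //; apply: le_lt_trans h.
  by rewrite ler_peMl ?nm_ge0.
- exact: cvg_cst.
- rewrite -[X in _ --> X](mulr0 (2 * c)).
  by apply: cvgM; [exact: cvg_cst|exact: nm0].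
Qed.

End DerivativeAtZero.

(** * Equivalence of the conditions *)

(** Common form of (iii), with both base points equal to X, and of (iv), with both equal to I:
    rescaling logarithms by t multiplies the balance integrals by t. *)
Lemma cartan_push_scale (R : realType) (m : nat) (nu : {measure set PDm R m -> \bar R})
    (f : PDm R m -> PDm R m) (Y Z : PD R m) (t : R) :
  nu [set: PDm R m] = 1%E -> P1 nu -> measurable_fun [set: PDm R m] f ->
  (forall A, Lg Z (f A) = t%:C *: Lg Y A) ->
  (balanced nu Y -> Z = cartan (push nu f)) /\
  (t != 0 -> Z = cartan (push nu f) -> balanced nu Y).
Proof.
move=> nu1 nuP1 mf hf.
have push1 := push_setT nu1 mf; have pushP1 := P1_push nu1 nuP1 mf hf.
have E := balanced_push nu1 nuP1 mf hf; split=> [bY|t0].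
  by apply/(cartanP push1 pushP1) => V aV; rewrite E bY // mulr0.
move=> /(cartanP push1 pushP1) bZ V aV; apply/eqP.
by have /eqP := bZ V aV; rewrite E mulf_eq0 (negbTE t0).
Qed.

Theorem theorem3p4 (R : realType) (m : nat) (X : PD R m)
    (mu : probability (PDm R m) R) :
  P1 mu ->
  let beta : R -> 'M[R[i]]_m := fun t => val (cartan (push mu (geoPD X t))) in
  let cond_i := forall i j : 'I_m,
      is_derive (0 : R) (1 : R) (fun t => complex.Re (beta t i j)) 0 /\
      is_derive (0 : R) (1 : R) (fun t => complex.Im (beta t i j)) 0 in
  let cond_ii := X = cartan mu in
  let cond_iii := forall t : R, X = cartan (push mu (geoPD X t)) in
  let cond_iii' := exists t : R, t != 0 /\ X = cartan (push mu (geoPD X t)) in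
  let muX := push mu (congrPD X) in
  let cond_iv := forall t : R, val (cartan (push muX (powPD t))) = 1%:M in
  let cond_iv' := exists t : R, t != 0 /\ val (cartan (push muX (powPD t))) = 1%:M in
  [/\ cond_i <-> cond_ii, cond_ii <-> cond_iii, cond_iii <-> cond_iii',
      cond_ii <-> cond_iv & cond_iv <-> cond_iv'].
Proof.
move=> muP1 beta cond_i cond_ii cond_iii cond_iii' muX cond_iv cond_iv'.
have mu1 : mu [set: PDm R m] = 1%E := probability_setT mu.
have iii_bal t := cartan_push_scale mu1 muP1 (measurable_geoPD X t) (Lg_geoPD X t).
have hcongr A : Lg (PDone R m) (congrPD X A) = (1 : R)%:C *: Lg X A.
  by rewrite Lg_congrPD scale1r.
have muX1 : muX [set: PDm R m] = 1%E := push_setT mu1 (measurable_congrPD X).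
have muXP1 : P1 muX := P1_push mu1 muP1 (measurable_congrPD X) hcongr.
have muXE V := balanced_push mu1 muP1 (measurable_congrPD X) hcongr V.
have iv_bal t := cartan_push_scale muX1 muXP1
  (@measurable_powPD R m t) (Lg_powPD t).
have bal_muX : balanced mu X <-> balanced muX (PDone R m).
  split=> bX V aV; first by rewrite muXE mul1r bX.
  by have := bX V aV; rewrite muXE mul1r.
have valone (Z : PD R m) : val Z = 1%:M <-> PDone R m = Z.
  by split=> [e|<- //]; apply: val_inj; rewrite e.
(* Each condition is compared with balance of X alone; the required equivalences then follow
   propositionally. *)
have iiP : cond_ii <-> balanced mu X := cartanP mu1 muP1 X.
have iiiP : cond_iii <-> balanced mu X.
  split=> [/(_ 1)|bX t]; first exact: (iii_bal 1).2 (oner_neq0 R).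
  exact: (iii_bal t).1.
have iii'P : cond_iii' <-> balanced mu X.
  split=> [[t [t0]]|bX]; first exact: (iii_bal t).2.
  by exists 1; split; [exact: oner_neq0|exact: (iii_bal 1).1].
have ivP : cond_iv <-> balanced mu X.
  split=> [/(_ 1) /valone e|bX t].
    by apply/bal_muX; exact: (iv_bal 1).2 (oner_neq0 R) e.
  by apply/valone; apply: (iv_bal t).1; apply/bal_muX.
have iv'P : cond_iv' <-> balanced mu X.
  split=> [[t [t0 /valone e]]|bX].
    by apply/bal_muX; exact: (iv_bal t).2 t0 e.
  exists 1; split; first exact: oner_neq0.
  by apply/valone; apply: (iv_bal 1).1; apply/bal_muX.
have iP : cond_i <-> balanced mu X.
  split=> [hi|bX].
    have mg t := measurable_geoPD X t.
    (* At t = 0 the balance integrals vanish whatever [mu] is; this identifies the base point of the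
       difference quotients as X. *)
    have beta0 : X = cartan (push mu (geoPD X 0)).
      apply/(cartanP (push_setT mu1 (mg 0)) (P1_push mu1 muP1 (mg 0) (Lg_geoPD X 0))) => V _.
      by rewrite (balanced_push mu1 muP1 (mg 0) (Lg_geoPD X 0)) mul0r.
    have valX : beta 0 = val X by rewrite /beta -beta0.
    apply: (@balanced_of_small_time _ _ mu X (fun n => geoPD X n.+1%:R^-1)
      (fun n => cartan (push mu (geoPD X n.+1%:R^-1))) mu1 muP1).
    - by move=> n; exact: mg.
    - by move=> n A; exact: Lg_geoPD.
    - move=> n; apply: cartan_minimizer; first exact: push_setT.
      exact: (P1_push mu1 muP1 (mg _) (Lg_geoPD X _)).
    - apply: cvg_dist_of_entries => i j; rewrite -valX.
        exact: is_derive_cvg_seq (hi i j).1.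
      exact: is_derive_cvg_seq (hi i j).2.
  (* If X is balanced, beta is constant, so its derivative vanishes. *)
  move=> i j; have betaE : beta = fun=> val X by apply/funext => t; rewrite /beta -(iii_bal t).1.
  by rewrite betaE; split; exact: is_derive_cst.
by split; split=> h; tauto.
Qed.
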